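(* Let $\mathcal P$ be a positive definite planar algebra with isometric $Y\in P_3$, and let $\mathcal R:P_4\to P_4$ be its renormalisation dynamical system. If $\{X_i\}_{i=1,2,3,\dots}$ is a sequence of elements of $P_4$ obtained by back-iterating $\mathcal R$, i.e. such that $\mathcal R(X_{i+1})=X_i$ for all $i\geq 1$, then putting $L_w=X_{\mathrm{length}(w)}$ for the words $w$ coding the leaves of all trees gives a weakly scale invariant transfer matrix: $\langle T^L_t(\iota_s^t\xi),\iota_s^t\eta\rangle=\langle T^L_s\xi,\eta\rangle$ for all trees $s\le t$ and $\xi,\eta\in\mathcal H_s$.
   Context: $\mathcal P=(P_n)$ is an unshaded positive definite planar algebra with finite dimensional spaces $P_n$ and inner products $\langle R,S\rangle$ given by gluing $R$ to $S^*$ along all boundary points. $Y\in P_3$, with boundary points clockwise (bottom, top left, top right), is isometric: gluing $Y$ to its adjoint (upside-down) $Y^*$ along the two top legs gives a single strand. Direct system: $\mathfrak T$ is the directed set of planar binary rooted trees, $s\le t$ iff $s$ is a rooted subtree of $t$; $\mathcal H_t=P_k$ if $t$ has $k$ leaves (boundary points numbered clockwise, corresponding to leaves from left to right). If $t$ is obtained from $s$ by a binary branching at the $i$-th leaf, $\iota_s^t$ attaches the bottom leg of $Y$ to the $i$-th boundary point; general $\iota_s^t$ are compositions. The boundary points of elements of $P_4$ are called $N,E,S,W$ clockwise. For $L_1,\dots,L_k\in P_4$ the transfer matrix $T(L_1,\dots,L_k):P_k\to P_k$ (periodic boundary conditions) sends $\xi$ to the diagram with $\xi$ in an inner disc, surrounded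 clockwise by $L_1,\dots,L_k$, $S$ of $L_i$ joined to the $i$-th boundary point of $\xi$, $E$ of $L_i$ joined to $W$ of $L_{i+1}$ (mod $k$), $N$ of $L_i$ being the $i$-th outer boundary point. Each leaf is coded by the word on $\{0,1\}$ read from root to leaf ($0$ left, $1$ right); if the leaves of $t$ have words $w_1,\dots,w_k$ then $T^L_t=T(L_{w_1},\dots,L_{w_k})$. For $x,y\in P_4$, $x\,!\,y\in P_4$ is the diagram in which $E$ of $x$ is joined to $W$ of $y$; $S$ of $x$ and $S$ of $y$ are joined to the top left and top right legs of a copy of $Y$ whose bottom leg is the outer $S$; $N$ of $x$ and $N$ of $y$ are joined to the two (left and right) legs of a copy of $Y^*$ whose remaining leg is the outer $N$; outer $W$ is $W$ of $x$ and outer $E$ is $E$ of $y$. The renormalisation dynamical system is the quadratic map $\mathcal R(X)=X\,!\,X$. For the one-leaf tree (empty word) the convention $X_0:=\mathcal R(X_1)$ is used. *)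

(* Defs.v *)
From mathcomp Require Import all_boot all_order all_algebra.
From mathcomp Require Import reals complex.
From mathcomp Require Import zify.
From Stdlib Require Import Relation_Operators.

Set Implicit Arguments.
Unset Strict Implicit.
Unset Printing Implicit Defensive.

Import Order.TTheory GRing.Theory Num.Theory.
Local Open Scope ring_scope.
Local Open Scope nat_scope.

(** * Planar tangles

    A planar n-tangle, up to planar isotopy, is recorded by its cell
    structure.  A disc with m boundary points carries a marked boundary
    interval; its points are numbered 0, ..., m-1 clockwise starting from
    that interval, and corner 0 is the marked interval while corner i (i > 0)
    is the interval between the points i-1 and i.  A disc without boundary
    points has exactly one corner; hence corners live in ['I_m.-1.+1].  The
    outer boundary circle is the vertex [None] and is also numbered
    clockwise, as seen from inside the tangle.

    Strings are open strands or closed loops.  An oriented string is a pair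
    (string, direction); [start v i] is the string at the i-th point of v,
    oriented away from the circle v, and [left_of o] is the region on the left
    hand side of the oriented string o. *)

Definition varity (D : Type) (n : nat) (ar : D -> nat) (v : option D) : nat :=
  if v is Some d then ar d else n.

Definition flip (A : Type) (o : A * bool) : A * bool := (o.1, ~~ o.2).

Record pretangle (n : nat) := PreTangle {
  disc : finType;
  arity : disc -> nat;
  string : finType;
  region : finType;
  start : forall v : option disc, 'I_(varity n arity v) -> string * bool;
  left_of : string * bool -> region;
  corner : forall v : option disc, 'I_(varity n arity v).-1.+1 -> region
}.

Arguments arity {n} _ _.
Arguments start {n} _ _ _.
Arguments left_of {n} _ _.
Arguments corner {n} _ _ _.

Section Planarity.
Variables (n : nat) (T : pretangle n).

Notation ar := (varity n (arity T)).

Definition start_point (p : {v : option (disc T) & 'I_(ar v)}) :=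
  start T (tag p) (tagged p).

(* The left side of a string leaving an input disc at its i-th point is the
   corner before i; the clockwise order is reversed for someone entering the
   tangle from the outer circle. *)
Definition sides_ok : Prop :=
  (forall d (i : 'I_(ar (Some d))),
     left_of T (start T (Some d) i) = corner T (Some d) (inZp i) /\
     left_of T (flip (start T (Some d) i)) = corner T (Some d) (inZp i.+1)) /\
  (forall i : 'I_(ar None),
     left_of T (start T None i) = corner T None (inZp i.+1) /\
     left_of T (flip (start T None i)) = corner T None (inZp i)).

Definition incident (v : option (disc T)) (s : string T) : bool :=
  [exists i : 'I_(ar v), (start T v i).1 == s].

Definition skeleton : rel (option (disc T) + string T) := fun x y =>
  match x, y with
  | inl v, inr s | inr s, inl v => incident v s
  | _, _ => false
  end.

Definition cells : rel (option (disc T) + string T + region T) := fun x y =>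
  match x, y with
  | inl a, inl b => skeleton a b
  | inl (inl v), inr r | inr r, inl (inl v) =>
      [exists i : 'I_(ar v).-1.+1, corner T v i == r]
  | inl (inr s), inr r | inr r, inl (inr s) =>
      (left_of T (s, true) == r) || (left_of T (s, false) == r)
  | inr _, inr _ => false
  end.

(* On the sphere obtained by collapsing every disc, and the outside of the
   tangle, to a vertex: V - E + F = 1 + C, where C is the number of connected
   components of the graph.  The open strands number half the boundary points;
   a closed loop adds one vertex and one edge, so it only counts in C. *)
Definition euler : Prop :=
  (#|disc T|.+1 + #|region T|).*2 =
  n + \sum_(d : disc T) arity T d + (1 + n_comp skeleton predT).*2.

Definition planar : Prop :=
  [/\ injective start_point,
      forall v (i : 'I_(ar v)),
        exists w (j : 'I_(ar w)), start T w j = flip (start T v i),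
      sides_ok,
      forall x, connect cells (inl (inl None)) x
    & euler].

End Planarity.

Record tangle (n : nat) := Tangle {
  tangle_data :> pretangle n;
  tangle_planar : planar tangle_data
}.

(** Orientation preserving ([refl = false]) or reversing ([refl = true])
    homeomorphisms between tangles, with matching marked intervals. *)
Record tangle_homeo (refl : bool) (n : nat) (T T' : pretangle n)
    (fd : disc T -> disc T') (fs : string T * bool -> string T' * bool)
    (fr : region T -> region T') : Prop := TangleHomeo {
  homeo_disc_bij : bijective fd;
  homeo_string_bij : bijective fs;
  homeo_region_bij : bijective fr;
  homeo_arity : forall d, arity T' (fd d) = arity T d;
  homeo_flip : forall o, fs (flip o) = flip (fs o);
  homeo_start : forall v (i : 'I_(varity n (arity T) v))
      (j : 'I_(varity n (arity T') (omap fd v))),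
    (if refl then (i + j).+1 = varity n (arity T) v else i = j :> nat) ->
    start T' (omap fd v) j = fs (start T v i);
  homeo_left : forall o,
    left_of T' (fs o) = fr (left_of T (if refl then flip o else o));
  homeo_corner : forall v (i : 'I_(varity n (arity T) v).-1.+1)
      (j : 'I_(varity n (arity T') (omap fd v)).-1.+1),
    (if refl then (i + j) %% varity n (arity T) v = 0 else i = j :> nat) ->
    corner T' (omap fd v) j = fr (corner T v i)
}.

(** Gluing: [U] is obtained by inserting [S] into the input disc [d] of [T].
    Strings and regions of [U] are those of [T] and [S] modulo the
    identifications along the boundary circle of [d]; an identified chain of
    strings without endpoints left becomes a closed loop of [U]. *)
Section Gluing.
Variables (n : nat) (T : pretangle n) (d : disc T).
Variables (S : pretangle (arity T d)) (U : pretangle n).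

Inductive glue_string :
    string T * bool + string S * bool -> string T * bool + string S * bool -> Prop :=
| GlueIn (i : 'I_(arity T d)) :
    glue_string (inl (start T (Some d) i)) (inr (flip (start S None i)))
| GlueOut (i : 'I_(arity T d)) :
    glue_string (inl (flip (start T (Some d) i))) (inr (start S None i)).

Inductive glue_region : region T + region S -> region T + region S -> Prop :=
| GlueRegion (i : 'I_(arity T d).-1.+1) :
    glue_region (inl (corner T (Some d) i)) (inr (corner S None i)).

Definition is_quotient (A B : Type) (R : A -> A -> Prop) (f : A -> B) : Prop :=
  (forall b, exists a, f a = b) /\
  (forall a a', f a = f a' <-> clos_refl_sym_trans A R a a').

Definition sum_arity (x : disc T + disc S) : nat :=
  match x with inl e => arity T e | inr e => arity S e end.

Record glued (origin : disc U -> disc T + disc S)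
    (gs : string T * bool + string S * bool -> string U * bool)
    (gr : region T + region S -> region U) : Prop := Glued {
  glued_origin_inj : injective origin;
  glued_origin_im : forall x, (exists u, origin u = x) <-> x <> inl d;
  glued_arity : forall u, arity U u = sum_arity (origin u);
  glued_string : is_quotient glue_string gs;
  glued_region : is_quotient glue_region gr;
  glued_flip : forall o, gs (match o with inl a => inl (flip a)
                                            | inr a => inr (flip a) end)
                         = flip (gs o);
  glued_left : forall o, left_of U (gs o) =
    gr (match o with inl a => inl (left_of T a) | inr a => inr (left_of S a) end);
  glued_start_outer : forall i : 'I_n, start U None i = gs (inl (start T None i));
  glued_start_inl : forall u e (i : 'I_(arity U u)) (j : 'I_(arity T e)),
    origin u = inl e -> i = j :> nat ->
    start U (Some u) i = gs (inl (start T (Some e) j));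
  glued_start_inr : forall u e (i : 'I_(arity U u)) (j : 'I_(arity S e)),
    origin u = inr e -> i = j :> nat ->
    start U (Some u) i = gs (inr (start S (Some e) j));
  glued_corner_outer : forall i : 'I_n.-1.+1,
    corner U None i = gr (inl (corner T None i));
  glued_corner_inl : forall u e (i : 'I_(arity U u).-1.+1) (j : 'I_(arity T e).-1.+1),
    origin u = inl e -> i = j :> nat ->
    corner U (Some u) i = gr (inl (corner T (Some e) j));
  glued_corner_inr : forall u e (i : 'I_(arity U u).-1.+1) (j : 'I_(arity S e).-1.+1),
    origin u = inr e -> i = j :> nat ->
    corner U (Some u) i = gr (inr (corner S (Some e) j))
}.

End Gluing.

Lemma skeleton_sym n (T : pretangle n) : symmetric (@skeleton n T).
Proof. by move=> [v|s] [w|t]. Qed.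

Lemma cells_sym n (T : pretangle n) : symmetric (@cells n T).
Proof. by move=> [[v|s]|r] [[w|t]|q] //=; rewrite skeleton_sym. Qed.

Lemma n_comp_skeleton1 n (T : pretangle n) :
  (forall x, connect (@skeleton n T) (inl None) x) ->
  n_comp (@skeleton n T) predT = 1.
Proof.
move=> cT; have sT := sym_connect_sym (@skeleton_sym n T).
rewrite -(n_comp_connect sT (inl None)); apply: eq_n_comp_r => x.
by rewrite inE; apply/esym/cT.
Qed.

Lemma connect_cells n (T : pretangle n) a b :
  connect (@skeleton n T) a b -> connect (@cells n T) (inl a) (inl b).
Proof.
case/connectP=> p + ->; elim: p a => [|c p IHp] a /=; first by rewrite connect0.
case/andP=> ac pp; apply: connect_trans (IHp _ pp); apply: connect1.
by case: a c ac {IHp pp} => [v|s] [w|t].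
Qed.

Lemma skeleton_start n (T : pretangle n) v (i : 'I_(varity n (arity T) v)) :
  @skeleton n T (inl v) (inr (start T v i).1).
Proof. by apply/existsP; exists i => /=. Qed.

Lemma cells_corner n (T : pretangle n) v (i : 'I_(varity n (arity T) v).-1.+1) :
  @cells n T (inl (inl v)) (inr (corner T v i)).
Proof. by apply/existsP; exists i => /=. Qed.

Lemma planar_connected n (T : pretangle n) :
  injective (@start_point n T) ->
  (forall v (i : 'I_(varity n (arity T) v)),
     exists w (j : 'I_(varity n (arity T) w)), start T w j = flip (start T v i)) ->
  @sides_ok n T ->
  (forall x, connect (@skeleton n T) (inl None) x) ->
  (forall r, exists v (i : 'I_(varity n (arity T) v).-1.+1), corner T v i = r) ->
  (#|disc T|.+1 + #|region T|).*2 = n + \sum_(d : disc T) arity T d + 4 ->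
  planar T.
Proof.
move=> Tinj Tend Tside Tconn Tcorner Tcard; split=> //.
- case=> [x|r]; first exact: connect_cells.
  have [v [i <-]] := Tcorner r.
  exact: connect_trans (connect_cells (Tconn (inl v))) (connect1 (cells_corner i)).
- by rewrite /euler n_comp_skeleton1.
Qed.


Definition empty_data : pretangle 0 :=
  @PreTangle 0 void (fun _ => 0) void unit
    (fun v => match v return 'I_(varity 0 (fun _ => 0) v) -> void * bool with
              | None => fun i => False_rect _ (notF (ltn_ord i))
              | Some d => match d with end end)
    (fun _ => tt) (fun _ _ => tt).

Lemma empty_planar : planar empty_data.
Proof.
apply: planar_connected.
- by move=> [[[]|] [i lti]].
- by move=> [[]|] [i lti].
- by split=> [[]|[i lti]].
- by move=> [[[]|]|[]]; apply: connect0.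
- by move=> []; exists None, ord0.
- by rewrite card_void card_unit big1 => [|[]].
Qed.

Definition empty_tangle : tangle 0 := Tangle empty_planar.

(* Identity tangle: region i lies before the i-th string. *)
Definition id_data (n : nat) : pretangle n :=
  @PreTangle n unit (fun _ => n) 'I_n 'I_n.-1.+1
    (fun v => match v return 'I_(varity n (fun _ => n) v) -> 'I_n * bool with
              | None => fun i => (i, false)
              | Some _ => fun i => (i, true) end)
    (fun o => if o.2 then inZp o.1 else inZp o.1.+1)
    (fun v => match v return 'I_(varity n (fun _ => n) v).-1.+1 -> 'I_n.-1.+1 with
              | None => id
              | Some _ => id end).

(* A single strand; point 0 is at the bottom and point 1 at the top, so that
   the marked interval is on the right. The region [true] is on the right. *)
Definition strand_data : pretangle 2 :=
  @PreTangle 2 void (fun _ => 0) unit bool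
    (fun v => match v return 'I_(varity 2 (fun _ => 0) v) -> unit * bool with
              | None => fun i => (tt, val i == 0)
              | Some d => match d with end end)
    (fun o => ~~ o.2)
    (fun v => match v return 'I_(varity 2 (fun _ => 0) v).-1.+1 -> bool with
              | None => fun i => val i == 0
              | Some d => match d with end end).

(* R (disc [false]) and S^* (disc [true]) glued along all their boundary
   points.  Reflection turns the i-th point of S into the point n-1-i of S^*.
   The outer circle lies in the common marked region of R and S^*. *)
Definition inner_data (n : nat) : pretangle 0 :=
  @PreTangle 0 bool (fun _ => n) 'I_n 'I_n.-1.+1
    (fun v => match v return 'I_(varity 0 (fun _ : bool => n) v) -> 'I_n * bool with
              | None => fun i => False_rect _ (notF (ltn_ord i))
              | Some false => fun i => (i, true)
              | Some true => fun i => (rev_ord i, false) end)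
    (fun o => if o.2 then inZp o.1 else inZp o.1.+1)
    (fun v => match v return 'I_(varity 0 (fun _ : bool => n) v).-1.+1 -> 'I_n.-1.+1 with
              | None => fun _ => ord0
              | Some false => id
              | Some true => fun i => inZp (n - i) end).

(* Y (disc [false]) with its two top legs joined to the bottom legs of Y^*
   (disc [true]).  The points of Y are (bottom, top left, top right), those of
   Y^* are therefore (bottom right, bottom left, top).
   Strings: [inl false] bottom leg, [inl true] top leg, [inr false] left leg,
   [inr true] right leg, all oriented away from Y or Y^* (Y for the legs
   joining both).  Regions: left, right, and [None] between the legs. *)
Definition isometry_data : pretangle 2 :=
  @PreTangle 2 bool (fun _ => 3) (bool + bool)%type (option bool)
    (fun v => match v return 'I_(varity 2 (fun _ : bool => 3) v) -> (bool + bool) * bool with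
              | None => fun i => (inl (val i == 1), false)
              | Some false => fun i => nth (inl false, true)
                  [:: (inl false, true); (inr false, true); (inr true, true)] i
              | Some true => fun i => nth (inl false, true)
                  [:: (inr true, false); (inr false, false); (inl true, true)] i
              end)
    (fun o => match o with
              | (inl b, c) => Some (b (+) c)
              | (inr false, true) => Some false
              | (inr true, false) => Some true
              | (inr _, _) => None end)
    (fun v => match v return 'I_(varity 2 (fun _ : bool => 3) v).-1.+1 -> option bool with
              | None => fun i => Some (val i == 0)
              | Some false => fun i => nth None [:: Some true; Some false; None] i
              | Some true => fun i => nth None [:: Some true; None; Some false] i
              end).

(* The bottom leg of Y (disc [true]) attached to the i-th of the k.+1 points of
   xi (disc [false]).  Strings: [inl j] leaves the j-th point of xi,
   [inr false] and [inr true] are the top left and top right legs of Y.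
   Regions: [Some j] lies before the j-th point of xi, [None] between the top
   legs of Y. *)
Definition attach_arity (k : nat) (d : bool) : nat := if d then 3 else k.+1.

Definition attach_data (k : nat) (i : 'I_k.+1) : pretangle k.+2 :=
  @PreTangle k.+2 bool (attach_arity k) ('I_k.+1 + bool)%type (option 'I_k.+1)
    (fun v => match v return 'I_(varity k.+2 (attach_arity k) v) -> ('I_k.+1 + bool) * bool with
              | None => fun p =>
                  if p < i then (inl (inord p), false)
                  else if p == i :> nat then (inr false, false)
                  else if p == i.+1 :> nat then (inr true, false)
                  else (inl (inord p.-1), false)
              | Some false => fun j => (inl j, true)
              | Some true => fun p => nth (inl i, false)
                  [:: (inl i, false); (inr false, true); (inr true, true)] p
              end)
    (fun o => match o with
              | (inl j, c) => Some (if c then j else ordS j)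
              | (inr false, true) => Some i
              | (inr true, false) => Some (ordS i)
              | (inr _, _) => None end)
    (fun v => match v return 'I_(varity k.+2 (attach_arity k) v).-1.+1 -> option 'I_k.+1 with
              | None => fun p =>
                  if p <= i then Some (inord p)
                  else if p == i.+1 :> nat then None
                  else Some (inord p.-1)
              | Some false => Some
              | Some true => fun p => nth None [:: Some (ordS i); Some i; None] p
              end).

(* The transfer matrix: xi is the disc [None], L_i the disc [Some i], with
   points (N, E, S, W).  Strings: [inl (inl i)] joins xi to S of L_i,
   [inl (inr i)] joins E of L_i to W of L_(i+1), [inr i] joins N of L_i to the
   i-th outer point.  Regions: [inl i] (resp. [inr i]) lies inside (resp.
   outside) the ring of the L_i, just before the i-th radius. *)
Definition transfer_arity (k : nat) (d : option 'I_k.+1) : nat :=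
  if d is Some _ then 4 else k.+1.

Definition transfer_data (k : nat) : pretangle k.+1 :=
  @PreTangle k.+1 (option 'I_k.+1) (@transfer_arity k)
    ('I_k.+1 + 'I_k.+1 + 'I_k.+1)%type ('I_k.+1 + 'I_k.+1)%type
    (fun v => match v return 'I_(varity k.+1 (@transfer_arity k) v) ->
                             ('I_k.+1 + 'I_k.+1 + 'I_k.+1) * bool with
              | None => fun i => (inr i, false)
              | Some None => fun i => (inl (inl i), true)
              | Some (Some i) => fun p => nth (inr i, true)
                  [:: (inr i, true); (inl (inr i), true);
                      (inl (inl i), false); (inl (inr (ord_pred i)), false)] p
              end)
    (fun o => match o with
              | (inl (inl i), c) => inl (if c then i else ordS i)
              | (inl (inr i), c) => if c then inr (ordS i) else inl (ordS i)
              | (inr i, c) => inr (if c then i else ordS i) end)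
    (fun v => match v return 'I_(varity k.+1 (@transfer_arity k) v).-1.+1 ->
                             'I_k.+1 + 'I_k.+1 with
              | None => inr
              | Some None => inl
              | Some (Some i) => fun p => nth (inr i)
                  [:: inr i; inr (ordS i); inl (ordS i); inl i] p
              end).

(* The diagram of x ! y.  Discs: [inl false], [inl true] are x, y with points
   (N, E, S, W); [inr false], [inr true] are Y, Y^*, numbered as above.
   Strings: [Some (inl k)] ends at the outer point k; [None] joins E of x to W
   of y; [Some (inr (b, c))] joins [inl b] to [inr c].  Regions: [inl k] is
   the outer corner k, [inr false] and [inr true] are the triangles x, y, Y and
   x, y, Y^*. *)
Definition bang_arity (d : bool + bool) : nat :=
  match d with inl _ => 4 | inr _ => 3 end.

Definition bang_string : finType := option ('I_4 + bool * bool).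

Definition bang_leg (k : nat) : bang_string := Some (inl (inord k)).
Definition bang_edge (b c : bool) : bang_string := Some (inr (b, c)).

Definition bang_data : pretangle 4 :=
  @PreTangle 4 (bool + bool)%type bang_arity bang_string ('I_4 + bool)%type
    (fun v => match v return 'I_(varity 4 bang_arity v) -> bang_string * bool with
              | None => fun i => (Some (inl i), false)
              | Some (inl false) => fun i => nth (None, true)
                  [:: (bang_edge false true, true); (None, true);
                      (bang_edge false false, true); (bang_leg 3, true)] i
              | Some (inl true) => fun i => nth (None, true)
                  [:: (bang_edge true true, true); (bang_leg 1, true);
                      (bang_edge true false, true); (None, false)] i
              | Some (inr false) => fun i => nth (None, true)
                  [:: (bang_leg 2, true); (bang_edge false false, false);
                      (bang_edge true false, false)] i
              | Some (inr true) => fun i => nth (None, true)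
                  [:: (bang_edge true true, false); (bang_edge false true, false);
                      (bang_leg 0, true)] i
              end)
    (fun o => match o with
              | (Some (inl k), c) => inl (if c then k else ordS k)
              | (None, c) => inr c
              | (Some (inr (false, true)), true) => inl (inord 0)
              | (Some (inr (true, true)), false) => inl (inord 1)
              | (Some (inr (true, false)), true) => inl (inord 2)
              | (Some (inr (false, false)), false) => inl (inord 3)
              | (Some (inr (_, t)), _) => inr t end)
    (fun v => match v return 'I_(varity 4 bang_arity v).-1.+1 -> 'I_4 + bool with
              | None => inl
              | Some (inl false) => fun i => nth (inr true)
                  [:: inl (inord 0); inr true; inr false; inl (inord 3)] i
              | Some (inl true) => fun i => nth (inr true)
                  [:: inr true; inl (inord 1); inl (inord 2); inr false] i
              | Some (inr false) => fun i => nth (inr true)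
                  [:: inl (inord 2); inl (inord 3); inr false] i
              | Some (inr true) => fun i => nth (inr true)
                  [:: inl (inord 1); inr true; inl (inord 0)] i
              end).

Lemma strand_planar : planar strand_data.
Proof.
apply: planar_connected.
- move=> [[[]|] [[|[|i]] lti]] [[[]|] [[|[|j]] ltj]] //= _;
    by congr existT; apply: val_inj.
- move=> [[]|] [[|[|i]] lti] //=.
  + by exists None, (@Ordinal 2 1 isT).
  + by exists None, (@Ordinal 2 0 isT).
- by split=> [[]|[[|[|i]] lti]].
- move=> [[[]|]|[]]; first exact: connect0.
  exact/connect1/(@skeleton_start _ strand_data None (@Ordinal 2 0 isT)).
- move=> [].
  + by exists None, (@Ordinal 2 0 isT).
  + by exists None, (@Ordinal 2 1 isT).
- by rewrite card_void card_bool big1 => [|[]].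
Qed.

Lemma isometry_planar : planar isometry_data.
Proof.
apply: planar_connected.
- move=> [[[]|] [[|[|[|i]]] lti]] [[[]|] [[|[|[|j]]] ltj]] //= _;
    by congr existT; apply: val_inj.
- move=> [[]|] [[|[|[|i]]] lti] //=.
  + by exists (Some false), (@Ordinal 3 2 isT).
  + by exists (Some false), (@Ordinal 3 1 isT).
  + by exists None, (@Ordinal 2 1 isT).
  + by exists None, (@Ordinal 2 0 isT).
  + by exists (Some true), (@Ordinal 3 1 isT).
  + by exists (Some true), (@Ordinal 3 0 isT).
  + by exists (Some false), (@Ordinal 3 0 isT).
  + by exists (Some true), (@Ordinal 3 2 isT).
- by split=> [[]|] [[|[|[|i]]] lti].
- have sym := sym_connect_sym (@skeleton_sym _ isometry_data).
  have st v i := connect1 (@skeleton_start _ isometry_data v i).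
  have s0 := st None (@Ordinal 2 0 isT).
  have s1 := st None (@Ordinal 2 1 isT).
  have y0 := st (Some false) (@Ordinal 3 0 isT).
  have y1 := st (Some false) (@Ordinal 3 1 isT).
  have y2 := st (Some false) (@Ordinal 3 2 isT).
  have z2 := st (Some true) (@Ordinal 3 2 isT).
  have cY : connect (@skeleton _ isometry_data) (inl None) (inl (Some false)).
    by apply: connect_trans s0 _; rewrite sym.
  have cZ : connect (@skeleton _ isometry_data) (inl None) (inl (Some true)).
    by apply: connect_trans s1 _; rewrite sym.
  move=> [[[]|]|[[]|[]]].
  + exact: cZ.
  + exact: cY.
  + exact: connect0.
  + exact: s1.
  + exact: s0.
  + exact: connect_trans cY y2.
  + exact: connect_trans cY y1.
- move=> [[]|].
  + by exists None, (@Ordinal 2 0 isT).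
  + by exists None, (@Ordinal 2 1 isT).
  + by exists (Some false), (@Ordinal 3 2 isT).
- by rewrite card_option !card_bool sum_nat_const card_bool.
Qed.

Lemma ordS_inZp k (i : 'I_k.+1) : ordS i = inZp i.+1.
Proof. exact: val_inj. Qed.

Lemma attach_outer k (i : 'I_k.+1) (p : 'I_k.+2) :
  let o := start (attach_data i) None p in
  [\/ exists2 j : 'I_k.+1, j < i /\ p = j :> nat & o = (inl j, false),
      p = i :> nat /\ o = (inr false, false),
      p = i.+1 :> nat /\ o = (inr true, false) |
      exists2 j : 'I_k.+1, i < j /\ p = j.+1 :> nat & o = (inl j, false)].
Proof.
have ltp := ltn_ord p; have lti := ltn_ord i; move=> /=.
case: ifP => pi.
  by apply: Or41; exists (inord p) => //; rewrite inordK; lia.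
case: eqP => [pi1|pi1]; first by apply: Or42.
case: eqP => [pi2|pi2]; first by apply: Or43.
by apply: Or44; exists (inord p.-1) => //; rewrite inordK; lia.
Qed.

Lemma attach_planar k i : planar (@attach_data k i).
Proof.
have lei : i <= k by rewrite -ltnS.
apply: planar_connected.
- move=> [v p] [w q]; rewrite /start_point /=.
  case: v p => [[|]|] p; case: w q => [[|]|] q /=.
  + case: p q => [[|[|[|p]]] ltp] [[|[|[|q]]] ltq] //= _;
      by congr existT; apply: val_inj.
  + by case: p => [[|[|[|p]]] ltp] //= [].
  + have [[j [ji qj]]|[qj]|[qj]|[j [ji qj]]] := attach_outer i q => /= ->;
      case: p => [[|[|[|p]]] ltp] //= [] e; move: ji; rewrite e; lia.
  + by case: q => [[|[|[|q]]] ltq] //= [].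
  + by case=> ->.
  + by have [[j _]|[_]|[_]|[j _]] := attach_outer i q => /= ->.
  + have [[j [ji qj]]|[qj]|[qj]|[j [ji qj]]] := attach_outer i p => /= ->;
      case: q => [[|[|[|q]]] ltq] //= [] e; move: ji; rewrite e; lia.
  + by have [[j _]|[_]|[_]|[j _]] := attach_outer i p => /= ->.
  + move=> e; congr existT; apply: val_inj; move: e => /=.
    have [[j [ji pj]]|[pj]|[pj]|[j [ji pj]]] := attach_outer i p => /= ->;
    have [[l [li ql]]|[ql]|[ql]|[l [li ql]]] := attach_outer i q => /= -> //;
      rewrite pj ql // => -[] e; move: ji; rewrite e; lia.
- move=> [[|]|] p /=.
  + case: p => [[|[|[|p]]] ltp] //=.
    * by exists (Some false), i.
    * have lti : i < k.+2 by lia.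
      by exists None, (Ordinal lti); rewrite /= ltnn eqxx.
    * have lti : i.+1 < k.+2 by lia.
      by exists None, (Ordinal lti); rewrite /= eqxx !ifN //; lia.
  + move: p; rewrite /= => p; have ltp := ltn_ord p.
    case: (ltngtP p i) => [lt_pi|lt_ip|/val_inj->]; last by exists (Some true), ord0.
    * have ltp2 : p < k.+2 by lia.
      by exists None, (Ordinal ltp2); rewrite /= lt_pi inord_val.
    * exists None, (Ordinal (ltp : p.+1 < k.+2)).
      by rewrite /= inord_val !ifN //; lia.
  + case: ifP => lt_pi; first by exists (Some false), (inord p).
    case: ifP => pi; first by exists (Some true), (@Ordinal 3 1 isT).
    case: ifP => pi1; first by exists (Some true), (@Ordinal 3 2 isT).
    by exists (Some false), (inord p.-1).
- split=> [[|] p|p] /=.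
  + by case: p => [[|[|[|p]]] ltp].
  + by rewrite ordS_inZp valZpK.
  + rewrite (modn_small (ltn_ord p)).
    have /= [[j [ji pj]]|[pj]|[pj]|[j [ji pj]]] := attach_outer i p => /= ->;
      rewrite /= pj.
    * rewrite modn_small ?ji ?(ltnW ji) ?inord_val; last by lia.
      split=> //; congr Some; apply: val_inj.
      have jk : j.+1 < k.+1 by lia.
      by rewrite /= inordK // modn_small.
    * by rewrite modn_small ?ltnn ?eqxx ?leqnn ?inord_val //; lia.
    * rewrite ltnn eqxx; split=> //.
      have [ik|ik] : i = k :> nat \/ i.+1 < k.+1 by lia.
        rewrite ik modnn /=; congr Some; apply: val_inj.
        by rewrite /= ik modnn inordK.
      rewrite modn_small ?ifN; try lia; congr Some; apply: val_inj.
      by rewrite /= inordK // modn_small.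
    * have jk := ltn_ord j; split; last by rewrite !ifN /= ?inord_val //; lia.
      have [ek|ljk] : j = k :> nat \/ j.+1 < k.+1 by lia.
        rewrite ek modnn /=; congr Some; apply: val_inj.
        by rewrite /= ek modnn inordK.
      rewrite modn_small ?ifN; try lia; congr Some; apply: val_inj.
      by rewrite /= inordK // modn_small.
- have sym := sym_connect_sym (@skeleton_sym _ (attach_data i)).
  have st v p := connect1 (@skeleton_start _ (attach_data i) v p).
  have cY : connect (@skeleton _ (attach_data i)) (inl None) (inl (Some true)).
    apply: connect_trans (st None (inord i)) _.
    rewrite /= !inordK ?ltnn ?eqxx; last by lia.
    by rewrite sym; exact: (st (Some true) (@Ordinal 3 1 isT)).
  have cX : connect (@skeleton _ (attach_data i)) (inl None) (inl (Some false)).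
    apply: connect_trans cY _.
    apply: connect_trans (st (Some true) ord0) _.
    by rewrite sym; exact: (st (Some false) i).
  move=> [[[]|]|[j|[]]].
  + exact: cY.
  + exact: cX.
  + exact: connect0.
  + exact: connect_trans cX (st (Some false) j).
  + exact: connect_trans cY (st (Some true) (@Ordinal 3 2 isT)).
  + exact: connect_trans cY (st (Some true) (@Ordinal 3 1 isT)).
- move=> [j|]; first by exists (Some false), j.
  by exists (Some true), (@Ordinal 3 2 isT).
- by rewrite card_option card_bool card_ord big_bool /=; lia.
Qed.

Lemma transfer_planar k : planar (transfer_data k).
Proof.
apply: planar_connected.
- move=> [v p] [w q]; rewrite /start_point /=.
  case: v p => [[a|]|] p; case: w q => [[b|]|] q //=.
  all: try by [case=> ->].
  all: try by case: p => [[|[|[|[|p]]]] ltp].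
  all: try by case: q => [[|[|[|[|q]]]] ltq].
  case: p q => [[|[|[|[|p]]]] ltp] [[|[|[|[|q]]]] ltq] //= [].
  all: try by move=> ->; congr existT; apply: val_inj.
  move=> e; have /ord_pred_inj -> : ord_pred a = ord_pred b by exact: val_inj.
  by congr existT; apply: val_inj.
- move=> [[a|]|] p /=.
  + case: p => [[|[|[|[|p]]]] ltp] //=.
    * by exists None, a.
    * by exists (Some (Some (ordS a))), (@Ordinal 4 3 isT); congr (inl (inr _), false); exact: ordSK.
    * by exists (Some None), a.
    * by exists (Some (Some (ord_pred a))), (@Ordinal 4 1 isT).
  + by exists (Some (Some p)), (@Ordinal 4 2 isT).
  + by exists (Some (Some p)), (@Ordinal 4 0 isT).
- split=> [[a|] p|p] /=.
  + by case: p => [[|[|[|[|p]]]] ltp] //=; rewrite ?ord_predK.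
  + by rewrite ordS_inZp valZpK.
  + by rewrite ordS_inZp valZpK.
- have sym := sym_connect_sym (@skeleton_sym _ (transfer_data k)).
  have st v i := connect1 (@skeleton_start _ (transfer_data k) v i).
  have cL a : connect (@skeleton _ (transfer_data k)) (inl None) (inl (Some (Some a))).
    apply: connect_trans (st None a) _.
    by rewrite sym; exact: (st (Some (Some a)) (@Ordinal 4 0 isT)).
  have cS a : connect (@skeleton _ (transfer_data k)) (inl None) (inr (inl (inl a))).
    exact: connect_trans (cL a) (st (Some (Some a)) (@Ordinal 4 2 isT)).
  move=> [[[a|]|]|[[a|a]|a]].
  + exact: cL.
  + apply: connect_trans (cS ord0) _.
    by rewrite sym; exact: (st (Some None) ord0).
  + exact: connect0.
  + exact: cS.
  + exact: connect_trans (cL a) (st (Some (Some a)) (@Ordinal 4 1 isT)).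
  + exact: st None a.
- move=> [a|a]; first by exists (Some None), a.
  by exists None, a.
- rewrite card_option card_sum !card_ord (bigD1 None) //=.
  rewrite (eq_bigr (fun=> 4)) => [|[a|]] //.
  by rewrite sum_nat_const cardC1 card_option card_ord; lia.
Qed.

Lemma n_comp_skeleton0 n (T : pretangle n) :
  (forall x y, @skeleton n T x y = false) ->
  n_comp (@skeleton n T) predT = #|{: option (disc T) + string T}|.
Proof.
move=> T0; have sT := sym_connect_sym (@skeleton_sym n T).
apply: eq_card => x; rewrite inE andbT /in_mem /= /roots.
have /connectP[[|y p] /= ep lp] := connect_root (@skeleton n T) x.
  by rewrite lp eqxx.
by rewrite T0 in ep.
Qed.

Lemma id_planar n : planar (id_data n).
Proof.
have ends v (i : 'I_(varity n (arity (id_data n)) v)) :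
    exists w (j : 'I_(varity n (arity (id_data n)) w)),
      start (id_data n) w j = flip (start (id_data n) v i).
  by case: v i => [[]|] i; [exists None, i | exists (Some tt), i].
have inj : injective (@start_point n (id_data n)).
  by move=> [[[]|] i] [[[]|] j] //= [->].
have sides : @sides_ok n (id_data n).
  by split=> [[]|] i.
case: n => [|n] in ends inj sides *.
  split=> //.
  - have st v i := connect1 (@cells_corner _ (id_data 0) v i).
    have c0 : connect (@cells _ (id_data 0)) (inl (inl None)) (inr ord0) := st None ord0.
    move=> [[[[]|]|[]]|r] //; last by rewrite [r]ord1.
    apply: connect_trans c0 _.
    by rewrite (sym_connect_sym (@cells_sym _ _)); exact: (st (Some tt) ord0).
  - rewrite /euler n_comp_skeleton0; last first.
      by move=> [[[]|]|[m //]] [[[]|]|[m' //]].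
    by rewrite card_sum card_option card_unit !card_ord big1.
apply: planar_connected => //.
- have st v i := connect1 (@skeleton_start _ (id_data n.+1) v i).
  move=> [[[]|]|i]; last exact: st None i.
    apply: connect_trans (st None ord0) _.
    by rewrite (sym_connect_sym (@skeleton_sym _ _)); exact: (st (Some tt) ord0).
  exact: connect0.
- by move=> r; exists None, r.
- by rewrite card_unit card_ord (eq_bigr (fun=> n.+1)) // sum_nat_const card_unit; lia.
Qed.

Lemma inner_planar n : planar (inner_data n).
Proof.
split.
- move=> [[[]|] i] [[[]|] j] //=; try by case: i.
  + by move=> /(congr1 fst) /= /rev_ord_inj->.
  + by case: j.
  + by case=> ->.
  + by case: j.
- move=> v i; case: v i => [b|] i; last by case: i.
  case: b i => i.
  + by exists (Some false), (rev_ord i).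
  + by exists (Some true), (rev_ord i); rewrite /= rev_ordK.
- split=> [[] i|[] //]; split=> //; apply: val_inj => /=.
    have := ltn_ord i => /=; move: (nat_of_ord i) => m; case: n i => [[]//|n] _ ltm /=.
    by congr (_ %% _); rewrite modn_small; lia.
  have := ltn_ord i => /=; move: (nat_of_ord i) => m; case: n i => [[]//|n] _ ltm /=.
  have [->|ltmn] : m = n \/ m.+1 < n.+1 by lia.
    by rewrite subnn modnn subn0 modnn.
  by rewrite (modn_small ltmn).
- have st v i := connect1 (@cells_corner _ (inner_data n) v i).
  have sym := sym_connect_sym (@cells_sym _ (inner_data n)).
  have c0 : connect (@cells _ (inner_data n)) (inl (inl None)) (inr ord0) := st None ord0.
  have cR : connect (@cells _ (inner_data n)) (inl (inl None)) (inl (inl (Some false))).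
    by apply: connect_trans c0 _; rewrite sym; exact: (st (Some false) ord0).
  have cS : connect (@cells _ (inner_data n)) (inl (inl None)) (inl (inl (Some true))).
    apply: connect_trans c0 _; rewrite sym.
    have := st (Some true) ord0; congr connect; congr inr; apply: val_inj => /=.
    by case: (n) => // m; rewrite subn0 modnn.
  move=> [[[[]|]|i]|r]; [exact: cS|exact: cR|exact: connect0| |].
    apply: connect_trans cR (connect_cells (connect1 _)).
    exact: (@skeleton_start _ (inner_data n) (Some false) i).
  exact: connect_trans cR (st (Some false) r).
- rewrite /euler sum_nat_const card_bool card_ord.
  case: n => [|n].
    rewrite n_comp_skeleton0; last by move=> [[[]|]|[m //]] [[[]|]|[m' //]].
    by rewrite card_sum card_option card_bool card_ord.
  have sym := sym_connect_sym (@skeleton_sym _ (inner_data n.+1)).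
  have st v i := connect1 (@skeleton_start _ (inner_data n.+1) v i).
  have out x : connect (@skeleton _ (inner_data n.+1)) (inl None) x = (x == inl None).
    apply/idP/eqP => [/connectP[[|y p] //= /andP[+ _] _]|->]; last exact: connect0.
    by case: y => // s /existsP[[]].
  have cR i : connect (@skeleton _ (inner_data n.+1)) (inl (Some false)) (inr i).
    exact: st (Some false) i.
  have cin x : x != inl None -> connect (@skeleton _ (inner_data n.+1)) (inl (Some false)) x.
    case: x => [[[]|]|i] // _; try by [exact: connect0 | exact: cR].
    apply: connect_trans (cR ord0) _; rewrite sym.
    have := st (Some true) (rev_ord ord0); congr connect; congr inr; exact: rev_ordK.
  have c1 : n_comp (@skeleton _ (inner_data n.+1)) (pred1 (inl None)) = 1.
    rewrite -(n_comp_connect sym (inl None)); apply: eq_n_comp_r => x.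
    exact/esym/out.
  have c2 : n_comp (@skeleton _ (inner_data n.+1)) [predC pred1 (inl None)] = 1.
    rewrite -(n_comp_connect sym (inl (Some false))); apply: eq_n_comp_r => x.
    apply/idP/idP => [/cin //|c]; apply/eqP => ex.
    have cR0 : connect (@skeleton _ (inner_data n.+1)) (inl (Some false)) (inl None).
      by rewrite -ex; exact: c.
    by rewrite sym out in cR0.
  by rewrite (@n_compC _ (pred1 (inl None))) c1 c2 /=; lia.
Qed.

Lemma bang_planar : planar bang_data.
Proof.
have o4E (i : 'I_4) : i = inord i by rewrite inord_val.
apply: planar_connected.
- pose g (o : bang_string * bool) : option (bool + bool) * nat :=
    match o with
    | (Some (inl k), false) => (None, val k)
    | (Some (inl k), true) => nth (None, 0)
        [:: (Some (inr true), 2); (Some (inl true), 1);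
            (Some (inr false), 0); (Some (inl false), 3)] (val k)
    | (None, b) => (Some (inl (~~ b)), if b then 1 else 3)
    | (Some (inr (b, c)), true) => (Some (inl b), if c then 0 else 2)
    | (Some (inr (b, c)), false) =>
        (Some (inr c), if b then (if c then 0 else 2) else 1)
    end.
  have gK p : g (start_point (T := bang_data) p) = (tag p, val (tagged p)).
    case: p => [[[[]|[]]|] i] //=; rewrite /start_point /=.
    1,2: by case: i => [[|[|[|[|i]]]] lti] //=; rewrite inordK.
    1,2: by case: i => [[|[|[|i]]] lti] //=; rewrite inordK.
  move=> p q /(congr1 g); rewrite !gK; case: p q => [v i] [w j] /= [].
  by move=> ew; case: w / ew j => j e; congr existT; apply: val_inj.
- move=> [[[]|[]]|] i.
  + case: i => [[|[|[|[|i]]]] lti] //=.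
    * by exists (Some (inr true)), (@Ordinal 3 0 isT).
    * by exists None, (inord 1).
    * by exists (Some (inr false)), (@Ordinal 3 2 isT).
    * by exists (Some (inl false)), (@Ordinal 4 1 isT).
  + case: i => [[|[|[|[|i]]]] lti] //=.
    * by exists (Some (inr true)), (@Ordinal 3 1 isT).
    * by exists (Some (inl true)), (@Ordinal 4 3 isT).
    * by exists (Some (inr false)), (@Ordinal 3 1 isT).
    * by exists None, (inord 3).
  + case: i => [[|[|[|i]]] lti] //=.
    * by exists (Some (inl true)), (@Ordinal 4 0 isT).
    * by exists (Some (inl false)), (@Ordinal 4 0 isT).
    * by exists None, (inord 0).
  + case: i => [[|[|[|i]]] lti] //=.
    * by exists None, (inord 2).
    * by exists (Some (inl false)), (@Ordinal 4 2 isT).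
    * by exists (Some (inl true)), (@Ordinal 4 2 isT).
  + rewrite (o4E i); case: i => [[|[|[|[|i]]]] lti] //=.
    * by exists (Some (inr true)), (@Ordinal 3 2 isT).
    * by exists (Some (inl true)), (@Ordinal 4 1 isT).
    * by exists (Some (inr false)), (@Ordinal 3 0 isT).
    * by exists (Some (inl false)), (@Ordinal 4 3 isT).
- have S4 k : k < 4 -> inl (ordS (inord k)) = inl (inord (k.+1 %% 4)) :> 'I_4 + bool.
    move=> ltk; congr inl; apply: val_inj => /=.
    by rewrite !inordK // ltn_mod.
  split=> [[[]|[]]|] i /=.
  1,2: by case: i => [[|[|[|[|i]]]] lti] //=; rewrite ?S4.
  1,2: by case: i => [[|[|[|i]]] lti] //=; rewrite ?S4.
  by split; congr inl; apply: val_inj => //=; rewrite modn_small.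
- have sym := sym_connect_sym (@skeleton_sym _ bang_data).
  have st v i := connect1 (@skeleton_start _ bang_data v i).
  have ts v i w : (start bang_data None (inord w)).1 = (start bang_data v i).1 ->
      connect (@skeleton _ bang_data) (inl None) (inl v).
    move=> e; apply: connect_trans (st None (inord w)) _.
    by rewrite e sym; exact: st.
  have cx := @ts (Some (inl false)) (@Ordinal 4 3 isT) 3 erefl.
  have cy := @ts (Some (inl true)) (@Ordinal 4 1 isT) 1 erefl.
  have cY := @ts (Some (inr false)) (@Ordinal 3 0 isT) 2 erefl.
  have cZ := @ts (Some (inr true)) (@Ordinal 3 2 isT) 0 erefl.
  move=> [[[[]|[]]|]|[[k|[[] []]]|]].
  + exact: cy.
  + exact: cx.
  + exact: cZ.
  + exact: cY.
  + exact: connect0.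
  + exact: st None k.
  + exact: connect_trans cy (st (Some (inl true)) (@Ordinal 4 0 isT)).
  + exact: connect_trans cy (st (Some (inl true)) (@Ordinal 4 2 isT)).
  + exact: connect_trans cx (st (Some (inl false)) (@Ordinal 4 0 isT)).
  + exact: connect_trans cx (st (Some (inl false)) (@Ordinal 4 2 isT)).
  + exact: connect_trans cx (st (Some (inl false)) (@Ordinal 4 1 isT)).
- move=> [k|[]]; first by exists None, k.
  + by exists (Some (inl true)), (@Ordinal 4 0 isT).
  + by exists (Some (inl true)), (@Ordinal 4 3 isT).
- by rewrite !card_sum card_ord !card_bool big_sumType /= !sum_nat_const card_bool.
Qed.

Definition id_tangle n : tangle n := Tangle (id_planar n).
Definition strand_tangle : tangle 2 := Tangle strand_planar.
Definition inner_tangle n : tangle 0 := Tangle (inner_planar n).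
Definition isometry_tangle : tangle 2 := Tangle isometry_planar.
Definition attach_tangle k (i : 'I_k.+1) : tangle k.+2 := Tangle (attach_planar i).
Definition transfer_tangle k : tangle k.+1 := Tangle (transfer_planar k).
Definition bang_tangle : tangle 4 := Tangle bang_planar.

(** * Planar algebras

    An (unshaded) planar *-algebra over the complex numbers, with finite
    dimensional spaces and dim P_0 = 1: every element of P_0 is a unique
    multiple of the empty tangle.  The spaces attached to discs of equal but
    not convertible arities are compared in [{k & P k}]. *)
Record planar_algebra (R : realType) := PlanarAlgebra {
  space :> nat -> vectType R[i];
  act : forall n (T : tangle n), (forall d : disc T, space (arity T d)) -> space n;
  star : forall n, space n -> space n;
  scalar : space 0 -> R[i];
  act_linear : forall n (T : tangle n) (x : forall d, space (arity T d))
      (d : disc T) (a : R[i]) (u v : space (arity T d)),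
    act (dfwith x (a *: u + v)%R) = (a *: act (dfwith x u) + act (dfwith x v))%R;
  act_isotopy : forall n (T T' : tangle n) fd fs fr
      (x : forall d, space (arity T d)) (x' : forall d, space (arity T' d)),
    @tangle_homeo false n T T' fd fs fr ->
    (forall d, Tagged space (x' (fd d)) = Tagged space (x d)) ->
    act x' = act x;
  act_id : forall n (x : space n), @act n (id_tangle n) (fun _ => x) = x;
  act_glue : forall n (T : tangle n) (d : disc T) (S : tangle (arity T d))
      (U : tangle n) origin gs gr
      (x : forall e, space (arity T e)) (y : forall e, space (arity S e))
      (z : forall e, space (arity U e)),
    @glued n T d S U origin gs gr ->
    (forall u, Tagged space (z u) = match origin u with
                                    | inl e => Tagged space (x e)
                                    | inr e => Tagged space (y e) end) ->
    act z = act (dfwith x (act y));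
  star_antilinear : forall n (a : R[i]) (u v : space n),
    star (a *: u + v)%R = (a^* *: star u + star v)%R;
  star_involutive : forall n, involutive (@star n);
  act_star : forall n (T T' : tangle n) fd fs fr
      (x : forall d, space (arity T d)) (x' : forall d, space (arity T' d)),
    @tangle_homeo true n T T' fd fs fr ->
    (forall d, Tagged space (x' (fd d)) = Tagged space (star (x d))) ->
    act x' = star (act x);
  empty_neq0 : @act 0 empty_tangle (fun d : void => match d with end) != 0%R;
  scalarE : forall x : space 0,
    x = (scalar x *: @act 0 empty_tangle (fun d : void => match d with end))%R
}.

Section Diagrams.
Variables (R : realType) (P : planar_algebra R).

Definition inner (n : nat) (x y : P n) : R[i] :=
  scalar (@act R P 0 (inner_tangle n) (fun b : bool => if b then star y else x)).

Definition positive_definite : Prop :=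
  forall n (x : P n), x != 0%R -> (0 < inner x x)%R.

Definition strand : P 2 := @act R P 2 strand_tangle (fun d : void => match d with end).

Definition isometric (Y : P 3) : Prop :=
  @act R P 2 isometry_tangle (fun b : bool => if b then star Y else Y) = strand.

Definition attach (Y : P 3) (k : nat) (i : 'I_k.+1) (xi : P k.+1) : P k.+2 :=
  @act R P k.+2 (attach_tangle i)
    (fun b : bool => match b return P (attach_arity k b) with
                     | false => xi | true => Y end).

Definition transfer (k : nat) (L : 'I_k.+1 -> P 4) (xi : P k.+1) : P k.+1 :=
  @act R P k.+1 (transfer_tangle k)
    (fun d : option 'I_k.+1 => match d return P (transfer_arity d) with
                               | None => xi | Some i => L i end).

Definition bang (Y : P 3) (x y : P 4) : P 4 :=
  @act R P 4 bang_tangle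
    (fun d : bool + bool => match d return P (bang_arity d) with
       | inl b => if b then y else x
       | inr b => if b then star Y else Y end).

Definition renorm (Y : P 3) (x : P 4) : P 4 := bang Y x x.

End Diagrams.


Inductive tree := Leaf | Node (l r : tree).

Fixpoint branchings (t : tree) : nat :=
  if t is Node l r then (branchings l + branchings r).+1 else 0.

Definition leaves (t : tree) : nat := (branchings t).+1.

Fixpoint words (t : tree) : seq (seq bool) :=
  if t is Node l r then map (cons false) (words l) ++ map (cons true) (words r)
  else [:: [::]].

Lemma size_words t : size (words t) = leaves t.
Proof.
elim: t => //= l IHl r IHr; rewrite size_cat !size_map IHl IHr.
by rewrite /leaves /= addSn addnS.
Qed.

Fixpoint subtree (s t : tree) : bool :=
  match s, t with
  | Leaf, _ => true
  | Node l r, Node l' r' => subtree l l' && subtree r r'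
  | Node _ _, Leaf => false
  end.

Fixpoint branch (t : tree) (i : nat) : tree :=
  match t with
  | Leaf => Node Leaf Leaf
  | Node l r => if i < leaves l then Node (branch l i) r
                else Node l (branch r (i - leaves l))
  end.

Lemma leaves_branch t i : (leaves t).+1 = leaves (branch t i).
Proof.
rewrite /leaves; congr _.+1.
by elim: t i => //= l IHl r IHr i; case: ifP => _ /=; rewrite -?IHl -?IHr ?addnS.
Qed.

Section DirectSystem.
Variables (R : realType) (P : planar_algebra R) (Y : P 3).

Definition tree_space (t : tree) : vectType R[i] := P (leaves t).

Definition cast_space m n (e : m = n) (x : P m) : P n := ecast k (P k) e x.

(* [connecting s t f] : f is iota_s^t, as a composition of elementary maps
   along some chain of branchings from s to t. *)
Inductive connecting (s : tree) :
    forall t, (tree_space s -> tree_space t) -> Prop :=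
| ConnectingRefl : connecting (fun xi => xi)
| ConnectingBranch t f (i : 'I_(leaves t)) : connecting f ->
    connecting (fun xi => cast_space (leaves_branch t i) (attach Y i (f xi))).

Definition tree_transfer (L : seq bool -> P 4) (t : tree) :
    tree_space t -> tree_space t :=
  transfer (fun i : 'I_(leaves t) => L (nth [::] (words t) i)).

Definition weakly_scale_invariant (L : seq bool -> P 4) : Prop :=
  forall s t, subtree s t ->
  forall f, connecting f ->
  forall xi eta : tree_space s,
    inner (tree_transfer L (f xi : tree_space t)) (f eta) =
    inner (tree_transfer L xi) eta.

(* The word of the only leaf of the one-leaf tree is empty; there X_0 is read
   as R(X_1), whatever the value of X at 0. *)
Definition length_labels (X : nat -> P 4) (w : seq bool) : P 4 :=
  if w is [::] then renorm Y (X 1) else X (size w).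

End DirectSystem.

Lemma subtree_refl : reflexive subtree.
Proof. by elim=> //= l -> r ->. Qed.

Lemma subtree_last_branch s t : subtree s t ->
  s = t \/ exists u (i : 'I_(leaves u)), subtree s u /\ t = branch u i.
Proof.
have inL l (i : 'I_(leaves l)) r :
    exists j : 'I_(leaves (Node l r)), Node (branch l i) r = branch (Node l r) j.
  have lti : i < leaves (Node l r) by rewrite (leq_trans (ltn_ord i)) // /leaves /=; lia.
  by exists (Ordinal lti); rewrite /= ltn_ord.
have inR l r (i : 'I_(leaves r)) :
    exists j : 'I_(leaves (Node l r)), Node l (branch r i) = branch (Node l r) j.
  have lti : leaves l + i < leaves (Node l r).
    by have := ltn_ord i; rewrite /leaves /=; lia.
  by exists (Ordinal lti); rewrite /= ltnNge leq_addr /= addKn.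
elim: t s => [|l IHl r IHr] [|sl sr] //=; first by left.
  move=> _; right; case: (IHl Leaf isT) => [<-|[u [i [su ->]]]]; last first.
    by have [j ->] := inL u i r; exists (Node u r), j.
  case: (IHr Leaf isT) => [<-|[u [i [su ->]]]]; first by exists Leaf, ord0.
  by have [j ->] := inR Leaf u i; exists (Node Leaf u), j.
case/andP=> sl_l sr_r; case: (IHl _ sl_l) => [<-|[u [i [su ->]]]]; last first.
  by right; have [j ->] := inL u i r; exists (Node u r), j; rewrite /= su.
case: (IHr _ sr_r) => [<-|[u [i [su ->]]]]; first by left.
by right; have [j ->] := inR sl u i; exists (Node sl u), j; rewrite /= su subtree_refl.
Qed.

Lemma connecting_exists (R : realType) (P : planar_algebra R) (Y : P 3) s t :
  subtree s t -> exists f : tree_space P s -> tree_space P t, connecting Y f.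
Proof.
have [m] := ubnP (leaves t); elim: m t => // m IHm t ltm st.
have [<-|[u [i [su et]]]] := subtree_last_branch st.
  by eexists; apply: ConnectingRefl.
rewrite {}et -leaves_branch in ltm *; have [f cf] := IHm u ltm su.
by eexists; apply: (ConnectingBranch i cf).
Qed.

(* Main.v *)
Require Import Defs.
From mathcomp Require Import all_boot all_order all_algebra.
From mathcomp Require Import reals complex zify.
From Stdlib Require Import Relation_Operators FunctionalExtensionality.

(** Consider one branching, at the i-th leaf, and labels L' of the branched
    tree.  The number <T(L') (Y attached to xi), Y attached to eta> is the value
    of a closed diagram.  The vectors xi and eta are separated there by a ring
    of the L'_j; a copy of Y joins the inner points of the two consecutive
    elements L'_i and L'_(i+1) at the new leaves, and a copy of Y^*, coming from
    the second argument of the inner product, joins their outer points.  These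
    four pieces are the diagram of L'_i ! L'_(i+1).  The same diagram therefore
    computes <T(L) xi, eta>, where L_i = L'_i ! L'_(i+1) and the other labels
    are unchanged ([inner_transfer_attach]).  By induction on the number of
    branchings, every family of labels with L_w = L_(w0) ! L_(w1) is weakly
    scale invariant ([weakly_scale_invariant_bang]), and labels that depend on
    the length of w alone satisfy this when they are obtained by back-iterating
    the quadratic map R.

    What has to be proved about diagrams is that two iterated insertions give
    the same planar tangle.

    - Insertion is constructed as an operation on cell structures ([glue]).
      The inserted tangle S is required to have a collar: its boundary points
      lie on distinct strands, its boundary intervals in distinct regions, and
      its discs and strings stay connected without the outer circle.  Then all
      strings and regions of T survive, those of S which touch the outer circle
      are absorbed by them, and Euler's formula for the result follows from
      those for T and S by addition ([glue_planar]).

    - A homeomorphism between planar tangles all of whose strings and regions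
      touch a disc or the outer circle is determined by its effect on boundary
      points and corners.  Bijectivity on strings follows from the
      injectivity of the numbering of their ends, and bijectivity on regions
      from Euler's formula ([homeo_of_starts]).

    - The equality of the two closed diagrams is obtained in two steps: Y
      attached to the second argument of the inner product moves to the first
      one as Y^* ([inner_attach]), and attaching Y inside and Y^* outside of a
      ring fuses two of its elements ([coattach_transfer_attach]). *)

Set Implicit Arguments.
Unset Strict Implicit.
Unset Printing Implicit Defensive.

Lemma connect_map (V W : finType) (e : rel V) (e' : rel W) (f : V -> W) x y :
  (forall a b, e a b -> connect e' (f a) (f b)) ->
  connect e x y -> connect e' (f x) (f y).
Proof.
move=> ef /connectP[p + ->]; elim: p x => [|z p IHp] x //= /andP[/ef xz /IHp].
exact: connect_trans.
Qed.

Lemma start_vertex n (T : pretangle n) : injective (@start_point n T) ->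
  forall v w (i : 'I_(varity n (arity T) v)) (j : 'I_(varity n (arity T) w)),
  start T v i = start T w j -> v = w.
Proof.
by move=> inj v w i j e; apply: (congr1 tag (inj (Tagged _ i) (Tagged _ j) e)).
Qed.

Lemma start_index n (T : pretangle n) : injective (@start_point n T) ->
  forall v, injective (start T v).
Proof.
move=> inj v i j e; have /eqP := inj (Tagged _ i) (Tagged _ j) e.
by rewrite -tag_eqE /tag_eq eqxx /= tagged_asE => /eqP.
Qed.

Lemma flipK (A : Type) : involutive (@flip A).
Proof. by case=> a b; rewrite /flip /= negbK. Qed.

(** * Inserting a tangle with a collar *)

Definition core n (T : pretangle n) : rel (option (disc T) + string T) :=
  fun x y => [&& x != inl None, y != inl None & @skeleton n T x y].

(** The condition on an inserted tangle which makes an insertion elementary.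
    Since no strand of S joins two boundary points, no chain of identified
    strings visits T twice and no closed loop is created; since the corners are
    distinct, no two regions of T are merged; since the inside of S is
    connected without its outer circle, replacing a disc by S preserves the
    number of connected components. *)
Record collared m (S : pretangle m) : Prop := Collared {
  collar_gt0 : 0 < m;
  collar_string : injective (fun i : 'I_m => (start S None i).1);
  collar_corner : injective (corner S None);
  collar_core : exists c, forall x, x != inl None -> connect (@core m S) c x
}.

Section Glue.
Variables (n : nat) (T : pretangle n) (d : disc T) (S : pretangle (arity T d)).

Definition glue_disc : finType := ({e : disc T | e != d} + disc S)%type.

(** A string or region of S which touches the outer circle is represented by
    the one of T that it continues, so only the others are kept. *)
Definition glue_strings : finType :=
  (string T + {s : string S | ~~ incident None s})%type.

Definition glue_regions : finType :=
  (region T + {r : region S | ~~ [exists i, corner S None i == r]})%type.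

Definition glue_arity (u : glue_disc) : nat :=
  match u with inl e => arity T (val e) | inr e => arity S e end.

(** The quotient map on oriented strings.  The i-th boundary point starts
    a string away from d in T and a string away from the outer circle in S;
    these two run in opposite directions along the same strand. *)
Definition string_class (o : string T * bool + string S * bool) : glue_strings * bool :=
  match o with
  | inl t => (inl t.1, t.2)
  | inr (s, c) =>
      match decP (@idP (@incident _ S None s)) with
      | left h =>
          let i := xchoose (existsP h) in
          let t := start T (Some d) i in
          (inl t.1, t.2 (+) (c == (start S None i).2))
      | right h => (inr (exist _ s (introN idP h)), c)
      end
  end.

Definition region_class (r : region T + region S) : glue_regions :=
  match r with
  | inl r => inl r
  | inr r =>
      match decP (@idP [exists i, corner S None i == r]) with
      | left h => inl (corner T (Some d) (xchoose (existsP h)))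
      | right h => inr (exist _ r (introN idP h))
      end
  end.

Definition glue : pretangle n :=
  @PreTangle n glue_disc glue_arity glue_strings glue_regions
    (fun v => match v return 'I_(varity n glue_arity v) -> glue_strings * bool with
              | None => fun i => string_class (inl (start T None i))
              | Some (inl e) => fun i => string_class (inl (start T (Some (val e)) i))
              | Some (inr e) => fun i => string_class (inr (start S (Some e) i))
              end)
    (fun o => match o with
              | (inl s, c) => inl (left_of T (s, c))
              | (inr s, c) => region_class (inr (left_of S (val s, c)))
              end)
    (fun v => match v return 'I_(varity n glue_arity v).-1.+1 -> glue_regions with
              | None => fun i => region_class (inl (corner T None i))
              | Some (inl e) => fun i => region_class (inl (corner T (Some (val e)) i))
              | Some (inr e) => fun i => region_class (inr (corner S (Some e) i))
              end).

Lemma string_class_flipl t : string_class (inl (flip t)) = flip (string_class (inl t)).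
Proof. by []. Qed.

Lemma string_class_flipr s : string_class (inr (flip s)) = flip (string_class (inr s)).
Proof.
case: s => s c; rewrite /string_class /flip /=; case: decP => // h /=.
by congr pair; case: c (start _ _ _) (start _ _ _).2 => [] [? []] [].
Qed.

Lemma string_class_inner s c (h : ~~ incident None s) :
  string_class (inr (s, c)) = (inr (exist _ s h), c).
Proof.
rewrite /string_class; case: decP => h'; first by case/negP: (h).
by rewrite (bool_irrelevance (introN idP h') h).
Qed.

Lemma region_class_inner r (h : ~~ [exists i, corner S None i == r]) :
  region_class (inr r) = inr (exist _ r h).
Proof.
rewrite /region_class; case: decP => h'; first by case/negP: (h).
by rewrite (bool_irrelevance (introN idP h') h).
Qed.

Definition glue_label (Q : nat -> Type) (x : forall e, Q (arity T e))
    (y : forall e, Q (arity S e)) (u : glue_disc) : Q (glue_arity u) :=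
  match u with inl e => x (val e) | inr e => y e end.

Section Collar.
Hypothesis cS : collared S.

Lemma string_class_outer i :
  string_class (inr (start S None i)) = string_class (inl (flip (start T (Some d) i))).
Proof.
case E: (start S None i) => [s c] /=; case: decP => [h|]; last first.
  by case; apply/existsP; exists i; rewrite E.
have /eqP := xchooseP (existsP h); set j := xchoose _ => ej.
have -> : j = i by apply: (collar_string cS); rewrite /= E.
by rewrite E eqxx addbT.
Qed.

Lemma region_class_outer i : region_class (inr (corner S None i)) = inl (corner T (Some d) i).
Proof.
rewrite /region_class; case: decP => [h|]; last by case; apply/existsP; exists i.
by congr inl; congr corner; apply: (collar_corner cS); apply/eqP/(xchooseP (existsP h)).
Qed.

Lemma string_cases (o : string S * bool) :
  [\/ exists h : ~~ incident None o.1, string_class (inr o) = (inr (exist _ o.1 h), o.2),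
      exists i, o = start S None i | exists i, o = flip (start S None i)].
Proof.
case: o => s c /=; have /orP[/existsP[i /eqP]|h] := orbN (@incident _ S None s);
  last by apply: Or31; exists h; exact: string_class_inner.
case E: (start S None i) => [s' c'] /= e.
have [ec|ec] := eqVneq c c'.
  by apply: Or32; exists i; rewrite E e ec.
by apply: Or33; exists i; rewrite E e /flip /=; case: c c' ec {E} => [] [].
Qed.

(** The tautological section of the quotient maps, which keeps the chosen
    representatives, shows that two cells with the same image are identified
    along the boundary circle of d. *)
Lemma glue_is_glued (sT : @sides_ok n T) (sS : @sides_ok _ S) :
  @glued n T d S glue
    (fun u : glue_disc => match u with inl e => inl (val e) | inr e => inr e end)
    string_class region_class.
Proof.
split.
- by move=> [e|e] [f|f] // [] => [/val_inj->|->].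
- case=> e; split.
  + by case=> [[f|f]] //= [<-] [] /eqP; apply/negP/(valP f).
  + move=> ed; have h : e != d by apply/eqP => ee; apply: ed; rewrite ee.
    by exists (inl (exist _ e h)).
  + by [].
  + by move=> _; exists (inr e).
- by case.
- split.
  + case=> [[s|s] c]; first by exists (inl (s, c)).
    exists (inr (val s, c)); rewrite (string_class_inner _ (valP s)).
    by congr (inr _, _); apply: val_inj.
  + pose sec (o : glue_strings * bool) : string T * bool + string S * bool :=
      match o with (inl s, c) => inl (s, c) | (inr s, c) => inr (val s, c) end.
    have secK a : clos_refl_sym_trans _ (@glue_string n T d S) a (sec (string_class a)).
      case: a => [[s c]|o]; first exact: rst_refl.
      have [[h ->]|[i ->]|[i ->]] := string_cases o.
      * by rewrite /= -surjective_pairing; exact: rst_refl.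
      * rewrite string_class_outer; case E: (start T (Some d) i) => [s c].
        by apply/rst_sym/rst_step; have := @GlueOut _ T d S i; rewrite E.
      * rewrite string_class_flipr string_class_outer; case E: (start T (Some d) i) => [s c].
        by apply/rst_sym/rst_step; have := @GlueIn _ T d S i; rewrite E /= negbK.
    move=> a b; split=> [e|].
      by apply: rst_trans (secK a) _; rewrite e; apply/rst_sym/secK.
    elim=> {a b} [a b []i|//|//|a b c _ -> _ ->//].
      by rewrite string_class_flipr string_class_outer string_class_flipl flipK.
    by rewrite string_class_outer.
- split.
  + case=> r; first by exists (inl r).
    exists (inr (val r)); rewrite (region_class_inner (valP r)).
    by congr inr; apply: val_inj.
  + pose sec (r : glue_regions) : region T + region S :=
      match r with inl r => inl r | inr r => inr (val r) end.
    have secK a : clos_refl_sym_trans _ (@glue_region n T d S) a (sec (region_class a)).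
      case: a => [r|r]; first exact: rst_refl.
      have /orP[/existsP[i /eqP<-]|h] := orbN [exists i, corner S None i == r];
        last by rewrite (region_class_inner h); exact: rst_refl.
      rewrite region_class_outer.
      exact/rst_sym/rst_step/(@GlueRegion _ T d S i).
    move=> a b; split=> [e|].
      by apply: rst_trans (secK a) _; rewrite e; apply/rst_sym/secK.
    elim=> {a b} [a b []i|//|//|a b c _ -> _ ->//].
    by rewrite region_class_outer.
- by case=> o; rewrite ?string_class_flipl ?string_class_flipr.
- case=> [[]//|o]; have [[h e]|[i ->]|[i ->]] := string_cases o.
  + by rewrite e /= -surjective_pairing.
  + have [[/(_ d i)[_ tl] _] [_ /(_ i)[-> _]]] := (sT, sS).
    by rewrite region_class_outer string_class_outer -tl.
  + have [[/(_ d i)[tl _] _] [_ /(_ i)[_ ->]]] := (sT, sS).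
    rewrite region_class_outer string_class_flipr string_class_outer.
    by rewrite string_class_flipl flipK -tl; case: start.
- by [].
- move=> [f|f] e i j //= [fe]; move: i j; rewrite -fe => i j ij.
  by congr (string_class (inl _)); congr start; apply: val_inj.
- move=> [f|f] e i j //= [fe]; move: i j; rewrite -fe => i j ij.
  by congr (string_class (inr _)); congr start; apply: val_inj.
- by [].
- move=> [f|f] e i j //= [fe]; move: i j; rewrite -fe => i j ij.
  by congr (region_class (inl _)); congr corner; apply: val_inj.
- move=> [f|f] e i j //= [fe]; move: i j; rewrite -fe => i j ij.
  by congr (region_class (inr _)); congr corner; apply: val_inj.
Qed.

End Collar.
End Glue.

Arguments glue {n} T d S.
Arguments string_class {n T d S} o : simpl never.
Arguments region_class {n T d S} r : simpl never.

Lemma collared_connected m (S : pretangle m) x : collared S ->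
  connect (@skeleton m S) (inl None) x.
Proof.
move=> cS; have symS := sym_connect_sym (@skeleton_sym m S).
have [c cc] := collar_core cS.
have C y : y != inl None -> connect (@skeleton m S) c y.
  by move/cc; apply: connect_sub => a b /and3P[_ _]; exact: connect1.
have st := connect1 (@skeleton_start _ S None (Ordinal (collar_gt0 cS))).
have [->|xN] := eqVneq x (inl None); first exact: connect0.
apply: connect_trans st _; rewrite symS.
by apply: connect_trans (C (inr _) isT); rewrite symS; exact: C.
Qed.

Section GluePlanar.
Variables (n : nat) (T : pretangle n) (d : disc T) (S : pretangle (arity T d)).
Hypotheses (pT : planar T) (pS : planar S) (cS : collared S).

Local Notation U := (glue T d S).
Local Notation gs := (@string_class n T d S).
Local Notation gr := (@region_class n T d S).

(** The other end of the strand is not on the outer circle, whose points lie on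
    distinct strands. *)
Lemma outer_end (i : 'I_(arity T d)) :
  exists e (j : 'I_(arity S e)), start S (Some e) j = flip (start S None i).
Proof.
have [_ /(_ None i)[[e|] [j e_j]] _ _ _] := pS; first by exists e, j.
have ji : j = i by apply: (collar_string cS); rewrite /= e_j.
by move: e_j; rewrite ji; case: start => s [].
Qed.

Lemma glue_sides : @sides_ok n U.
Proof.
have [[_ _ sT _ _] [_ _ sS _ _]] := (pT, pS).
have L := glued_left (glue_is_glued cS sT sS).
split.
  case=> [e|e] i.
  - have [/(_ (val e) i)[e1 e2] _] := sT.
    have := L (inl (start T (Some (val e)) i)); rewrite /= e1 => ->.
    by have := L (inl (flip (start T (Some (val e)) i))); rewrite /= e2 => ->.
  - have [/(_ e i)[e1 e2] _] := sS.
    have := L (inr (start S (Some e) i)); rewrite e1 => ->.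
    by have := L (inr (flip (start S (Some e) i))); rewrite e2 string_class_flipr => ->.
move=> i; have [_ /(_ i)[e1 e2]] := sT.
have := L (inl (start T None i)); rewrite /= e1 => ->.
by have := L (inl (flip (start T None i))); rewrite /= e2 => ->.
Qed.

Lemma inner_start e (j : 'I_(arity S e)) :
  let o := start S (Some e) j in
  (exists h : ~~ incident None o.1, gs (inr o) = (inr (exist _ o.1 h), o.2)) \/
  exists2 i, o = flip (start S None i) & gs (inr o) = gs (inl (start T (Some d) i)).
Proof.
have [injS _ _ _ _] := pS.
move=> o; have [h|[i e_i]|[i e_i]] := @string_cases n T d S o; first by left.
  by have := start_vertex injS e_i.
right; exists i => //.
by rewrite e_i string_class_flipr (string_class_outer cS) string_class_flipl flipK.
Qed.

Lemma string_class_inl_inj t t' : gs (inl t) = gs (inl t') -> t = t'.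
Proof. by case: t t' => [s c] [s' c'] [-> ->]. Qed.

Lemma glue_start_inj : injective (@start_point n U).
Proof.
have [[injT _ _ _ _] [injS _ _ _ _]] := (pT, pS).
have TS v (i : 'I_(varity n (arity T) v)) e (j : 'I_(arity S e)) :
    v != Some d -> gs (inl (start T v i)) <> gs (inr (start S (Some e) j)).
  move=> vd; have [[h ->] //|[l _ ->]] := inner_start j.
  by move/string_class_inl_inj => /(start_vertex injT) ev; rewrite ev eqxx in vd.
have SS e f (i : 'I_(arity S e)) (j : 'I_(arity S f)) :
    gs (inr (start S (Some e) i)) = gs (inr (start S (Some f) j)) ->
    start S (Some e) i = start S (Some f) j.
  have [[h he]|[l l1 l2]] := inner_start i; have [[k ke]|[m m1 m2]] := inner_start j.
  - rewrite he ke; case: (start S (Some e) i) h {he} => s c h.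
    by case: (start S (Some f) j) k {ke} => s' c' k [-> ->].
  - by rewrite he m2.
  - by rewrite l2 ke.
  - by rewrite l2 m2 l1 m1 => /string_class_inl_inj /(start_index injT) ->.
have dS (e : {e : disc T | e != d}) : Some (val e) != Some d.
  by apply/eqP => -[E]; have := valP e; rewrite /= E eqxx.
case=> [[[e|e]|] i] [[[f|f]|] j] //; rewrite /start_point /=.
- move/string_class_inl_inj => E; have [/val_inj ef] := start_vertex injT E.
  by move: i j E; rewrite -ef /= => i j /(start_index injT) ->.
- by move/TS => []; exact: dS.
- by move/string_class_inl_inj => /(start_vertex injT).
- by move=> E; case: (TS (Some (val f)) j _ i (dS f)).
- move/SS => E; have [ef] := start_vertex injS E.
  by move: i j E; rewrite -ef => i j /(start_index injS) ->.
- by move=> E; case: (@TS None j _ i).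
- by move/string_class_inl_inj => /(start_vertex injT).
- by move/TS => [].
- by move/string_class_inl_inj => /(start_index injT) ->.
Qed.

(** A strand of T ending at d is prolonged by the strand of S at the same
    point, which ends at a disc of S. *)
Lemma glue_start_l v (i : 'I_(varity n (arity T) v)) :
  exists w (j : 'I_(varity n (arity U) w)), start U w j = gs (inl (start T v i)).
Proof.
case: v i => [e|] i; last by exists None, i.
have [ed|ed] := eqVneq e d; last by exists (Some (inl (exist _ e ed))), i.
move: i; rewrite ed => i; have [f [j fj]] := outer_end i.
exists (Some (inr f)), j; rewrite /= fj string_class_flipr (string_class_outer cS).
by rewrite string_class_flipl flipK.
Qed.

Lemma glue_ends v (i : 'I_(varity n (arity U) v)) :
  exists w (j : 'I_(varity n (arity U) w)), start U w j = flip (start U v i).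
Proof.
have [[_ endT _ _ _] [_ endS _ _ _]] := (pT, pS).
case: v i => [[e|e]|] i.
- have [w [j e_j]] := endT (Some (val e)) i.
  have [w' [j' e_j']] := glue_start_l j; by exists w', j'; rewrite e_j' e_j.
- have [[f|] [j e_j]] := endS (Some e) i.
    by exists (Some (inr f)), j; rewrite -string_class_flipr -e_j.
  have [w [l e_l]] := endT (Some d) j.
  have [w' [l' e_l']] := glue_start_l l; exists w', l'.
  by rewrite e_l' /= -string_class_flipr -e_j (string_class_outer cS) e_l.
- have [w [j e_j]] := endT None i.
  have [w' [j' e_j']] := glue_start_l j; by exists w', j'; rewrite e_j' e_j.
Qed.

Lemma glue_incident_d (i : 'I_(arity T d)) :
  exists e, @incident _ U (Some (inr e)) (inl (start T (Some d) i).1).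
Proof.
have [e [j ej]] := outer_end i; exists e; apply/existsP; exists j.
by rewrite /= ej string_class_flipr (string_class_outer cS).
Qed.

Definition inserted (x : option (disc S) + string S) : option (disc U) + string U :=
  match x with
  | inl None => inl None
  | inl (Some e) => inl (Some (inr e))
  | inr s => inr (gs (inr (s, true))).1
  end.

Lemma string_class_unoriented o : (gs (inr o)).1 = (gs (inr (o.1, true))).1.
Proof.
case: o => s [] //=; have /= := congr1 fst (string_class_flipr (s, true)).
by rewrite /flip /= => ->.
Qed.

Lemma connect_inserted x y : x != inl None -> y != inl None ->
  connect (@skeleton n U) (inserted x) (inserted y).
Proof.
have sym := sym_connect_sym (@skeleton_sym n U).
have [c cc] := collar_core cS.
have E e s : @incident _ S (Some e) s ->
    connect (@skeleton n U) (inserted (inl (Some e))) (inserted (inr s)).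
  case/existsP=> j /eqP <-; apply: connect1; apply/existsP; exists j.
  by rewrite /= string_class_unoriented.
have C z : z != inl None -> connect (@skeleton n U) (inserted c) (inserted z).
  move/cc; apply: connect_map => {z} -[[a|]|a] [[b|]|b] /and3P[] //= _ _.
    exact: E.
  by move=> ?; rewrite sym; exact: E.
by move=> /C xC /C; apply: connect_trans; rewrite sym.
Qed.

(** Shrinking the inserted tangle to a point gives back the graph of T, with
    connected fibres; hence both graphs have the same connected components. *)
Definition contract (x : option (disc U) + string U) : option (disc T) + string T :=
  match x with
  | inl None => inl None
  | inl (Some (inl e)) => inl (Some (val e))
  | inr (inl s) => inr s
  | _ => inl (Some d)
  end.

Lemma glue_incident v s : v != Some d -> incident v s ->
  exists2 v', contract (inl v') = inl v & @incident _ U v' (inl s).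
Proof.
case: v => [e|] vd /existsP[i /eqP <-]; last first.
  by exists None => //; apply/existsP; exists i.
have ed : e != d by apply: contra vd => /eqP->.
by exists (Some (inl (exist _ e ed))) => //; apply/existsP; exists i.
Qed.

Lemma contract_fibre x y : contract x = contract y -> connect (@skeleton n U) x y.
Proof.
have D x' : contract x' = inl (Some d) -> exists2 y', y' != inl None & x' = inserted y'.
  case: x' => [[[e|e]|]|[s|s]] //=.
  - by case=> ed; have := valP e; rewrite /= ed eqxx.
  - by exists (inl (Some e)).
  - exists (inr (val s)) => //=; rewrite (string_class_inner _ (valP s)).
    by congr inr; congr inr; apply: val_inj.
have [ex exy|nx exy] := eqVneq (contract x) (inl (Some d)).
  have [x' x'N ->] := D x ex; have [y' y'N ->] := D y (etrans (esym exy) ex).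
  exact: connect_inserted.
suff -> : x = y by exact: connect0.
case: x y exy nx => [[[e|e]|]|[s|s]] [[[f|f]|]|[t|t]] //=; rewrite ?eqxx //.
- by case=> /val_inj ->.
- by move=> ->; rewrite eqxx.
- by move=> ->; rewrite eqxx.
- by case=> ->.
Qed.

Lemma contract_edge x y : @skeleton n U x y ->
  connect (@skeleton n T) (contract x) (contract y).
Proof.
have sym := sym_connect_sym (@skeleton_sym n T).
have E v s : @incident _ U v s ->
    connect (@skeleton n T) (contract (inl v)) (contract (inr s)).
  case: v => [[e|e]|] /existsP[i /eqP<-].
  - by apply: connect1; exact: (@skeleton_start _ T (Some (val e)) i).
  - have /= [[h ->]|[l _ ->]] := inner_start i; first exact: connect0.
    by apply: connect1; exact: (@skeleton_start _ T (Some d) l).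
  - by apply: connect1; exact: (@skeleton_start _ T None i).
case: x y => [v|s] [w|t] //= vs; first exact: E.
by rewrite sym; exact: E.
Qed.

Lemma contract_lift x z : @skeleton n T (contract x) z ->
  exists2 z', contract z' = z & connect (@skeleton n U) x z'.
Proof.
have sym := sym_connect_sym (@skeleton_sym n U).
have E v s : @incident _ T v s -> exists2 x', contract x' = inl v &
    @skeleton n U x' (inr (inl s)).
  move=> vs; have [ed|vd] := eqVneq v (Some d).
    move: vs; rewrite ed => /existsP[i /eqP<-].
    by have [e ie] := glue_incident_d i; exists (inl (Some (inr e))).
  by have [v' cv' iv'] := glue_incident vd vs; exists (inl v').
case: z => [w|t]; case ex: (contract x) => [v|s] //= i.
- have [x' x'1 x'2] := E _ _ i; exists x' => //.
  apply: connect_trans (contract_fibre (y := inr (inl s)) ex) _.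
  by rewrite sym; exact: connect1.
- have [x' x'1 x'2] := E _ _ i; exists (inr (inl t)) => //.
  apply: connect_trans (contract_fibre (y := x') _) (connect1 x'2).
  by rewrite ex x'1.
Qed.

Lemma contract_connect x y :
  connect (@skeleton n U) x y = connect (@skeleton n T) (contract x) (contract y).
Proof.
apply/idP/idP; first exact: connect_map contract_edge.
case/connectP=> p; elim: p x => [|z p IHp] x /=.
  by move=> _ e; apply: contract_fibre.
case/andP=> /contract_lift[z' <- xz'] pp /(IHp _ pp).
exact: connect_trans.
Qed.

Lemma n_comp_glue : n_comp (@skeleton n U) predT = n_comp (@skeleton n T) predT.
Proof.
have symU := sym_connect_sym (@skeleton_sym n U).
have symT := sym_connect_sym (@skeleton_sym n T).
apply/esym; rewrite (adjunction_n_comp contract symT symU (a := predT)) //.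
split=> [x _|x y _]; last exact: contract_connect.
case: x => [[e|]|s]; last by exists (inr (inl s)); exact: connect0.
  have [ed|ed] := eqVneq e d; last by exists (inl (Some (inl (exist _ e ed)))); exact: connect0.
  have m0 := collar_gt0 cS; exists (inr (inl (start T (Some d) (Ordinal m0)).1)).
  by rewrite ed; apply: connect1; exact: (@skeleton_start _ T (Some d)).
by exists (inl None); exact: connect0.
Qed.

Lemma cells_left m (V : pretangle m) o :
  @cells m V (inl (inr o.1)) (inr (left_of V o)).
Proof. by case: o => s [] /=; rewrite eqxx ?orbT. Qed.

(** Going around d, one meets in turn the corners and the strings at d, and
    these remain adjacent to one another after the insertion. *)
Lemma glue_annulus (i : 'I_(arity T d).-1.+1) :
  connect (@cells n U) (inr (inl (corner T (Some d) ord0)))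
    (inr (inl (corner T (Some d) i))).
Proof.
have symU := sym_connect_sym (@cells_sym n U).
have [_ _ [sT _] _ _] := pT.
rewrite -(valZpK i); elim: (val i) (ltn_ord i) => [_|k IHk ltk].
  by rewrite (_ : inZp 0 = ord0) ?connect0 //; apply: val_inj; rewrite /= mod0n.
apply: connect_trans (IHk (ltnW ltk)) _.
have ltm : k < arity T d by move: ltk; have := collar_gt0 cS; lia.
have [/= l1 l2] := sT d (Ordinal ltm).
have := connect1 (@cells_left _ U (gs (inl (start T (Some d) (Ordinal ltm))))).
have := connect1 (@cells_left _ U (gs (inl (flip (start T (Some d) (Ordinal ltm)))))).
rewrite /= -surjective_pairing l1.
rewrite [X in left_of T X](_ : _ = flip (start T (Some d) (Ordinal ltm))) // l2.
move=> c2 c1; apply: connect_trans c2.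
by rewrite symU.
Qed.

(** The cells of T and those of S are mapped into the glued tangle along
    paths, and both images meet on the annulus around d. *)
Lemma glue_cells x : connect (@cells n U) (inl (inl None)) x.
Proof.
have symU := sym_connect_sym (@cells_sym n U).
have [[_ _ sT cT _] [_ _ sS cS' _]] := (pT, pS).
(* The disc d of T and the outer circle of S are both sent to a region on their
   common boundary circle. *)
pose z : option (disc U) + string U + region U := inr (inl (corner T (Some d) ord0)).
pose hT (x : option (disc T) + string T + region T) : option (disc U) + string U + region U :=
  match x with
  | inl (inl None) => inl (inl None)
  | inl (inl (Some e)) => if insub e is Some e' then inl (inl (Some (inl e'))) else z
  | inl (inr s) => inl (inr (inl s))
  | inr r => inr (inl r)
  end.
pose hS (x : option (disc S) + string S + region S) : option (disc U) + string U + region U :=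
  match x with
  | inl (inl None) => z
  | inl (inl (Some e)) => inl (inl (Some (inr e)))
  | inl (inr s) => inl (inr (gs (inr (s, true))).1)
  | inr r => inr (gr (inr r))
  end.
have lT o : connect (@cells n U) (inl (inr (inl o.1))) (inr (inl (left_of T o))).
  have := connect1 (@cells_left _ U (gs (inl o))).
  by rewrite /= -surjective_pairing.
have lS o : connect (@cells n U) (inl (inr (gs (inr o)).1)) (inr (gr (inr (left_of S o)))).
  have := connect1 (@cells_left _ U (gs (inr o))).
  by rewrite (glued_left (glue_is_glued cS sT sS) (inr o)).
have Tvs v s : @incident _ T v s -> connect (@cells n U) (hT (inl (inl v))) (hT (inl (inr s))).
  move=> iv; have [ed|vd] := eqVneq v (Some d).
    move: iv; rewrite ed => /existsP[i /eqP<-] /=; rewrite insubF ?eqxx //.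
    apply: connect_trans (glue_annulus (inZp i)) _; rewrite symU.
    by have [/(_ d i)[<- _] _] := sT; exact: lT.
  case: v vd iv => [e|] vd /existsP[i /eqP<-]; last first.
    exact: (@connect_cells n U (inl _) (inr _) (connect1 (@skeleton_start _ U None i))).
  have ed : e != d by apply: contra vd => /eqP->.
  rewrite /= insubT; apply: (@connect_cells n U (inl _) (inr _)).
  exact: (connect1 (@skeleton_start _ U (Some (inl (exist _ e ed))) i)).
have Tvr v (i : 'I_(varity n (arity T) v).-1.+1) :
    connect (@cells n U) (hT (inl (inl v))) (hT (inr (corner T v i))).
  case: v i => [e|] i; last by apply: connect1; exact: (@cells_corner _ U None).
  have [ed|vd] := eqVneq e d.
    by move: i; rewrite ed => i /=; rewrite insubF ?eqxx //; exact: glue_annulus.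
  rewrite /= insubT; apply: connect1.
  exact: (@cells_corner _ U (Some (inl (exist _ e vd)))).
have HT a : connect (@cells n U) (inl (inl None)) (hT a).
  apply: connect_map (cT a) => {a} [] [[v|s]|r] [[w|t]|q] //=.
  - exact: Tvs.
  - by case/existsP=> i /eqP<-; exact: Tvr.
  - by move=> ?; rewrite symU; exact: Tvs.
  - by case/orP=> /eqP<-; [exact: (lT (s, true)) | exact: (lT (s, false))].
  - by case/existsP=> i /eqP<-; rewrite symU; exact: Tvr.
  - by case/orP=> /eqP<-; rewrite symU; [exact: (lT (t, true)) | exact: (lT (t, false))].
have Svs v s : @incident _ S v s -> connect (@cells n U) (hS (inl (inl v))) (hS (inl (inr s))).
  case/existsP=> i /eqP<-; case: v i => [e|] i /=.
    rewrite -string_class_unoriented.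
    exact: (@connect_cells n U (inl _) (inr _) (connect1 (@skeleton_start _ U (Some (inr e)) i))).
  rewrite -string_class_unoriented (string_class_outer cS).
  apply: connect_trans (glue_annulus (inZp i)) _; rewrite symU.
  by have [/(_ d i)[<- _] _] := sT; exact: lT.
have Svr v (i : 'I_(varity _ (arity S) v).-1.+1) :
    connect (@cells n U) (hS (inl (inl v))) (hS (inr (corner S v i))).
  case: v i => [e|] i; first by apply: connect1; exact: (@cells_corner _ U (Some (inr e))).
  by rewrite /= (region_class_outer cS); exact: glue_annulus.
have HS a : connect (@cells n U) z (hS a).
  apply: connect_map (cS' a) => {a} [] [[v|s]|r] [[w|t]|q] //=.
  - exact: Svs.
  - by case/existsP=> i /eqP<-; exact: Svr.
  - by move=> ?; rewrite symU; exact: Svs.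
  - case/orP=> /eqP<-; first exact: (lS (s, true)).
    by have := lS (s, false); rewrite string_class_unoriented.
  - by case/existsP=> i /eqP<-; rewrite symU; exact: Svr.
  - case/orP=> /eqP<-; rewrite symU; first exact: (lS (t, true)).
    by have := lS (t, false); rewrite string_class_unoriented.
have Hz := HT (inr (corner T (Some d) ord0)).
case: x => [[[[e|e]|]|[s|s]]|[r|r]].
- have := HT (inl (inl (Some (val e)))); rewrite /= insubT ?(valP e) // => h.
  by congr connect; congr inl; congr inl; congr (Some (inl _)); apply: val_inj.
- exact: connect_trans Hz (HS (inl (inl (Some e)))).
- exact: connect0.
- exact: HT (inl (inr s)).
- apply: connect_trans Hz _; have := HS (inl (inr (val s))).
  rewrite /= (string_class_inner _ (valP s)).
  by congr connect; congr inl; congr inr; congr inr; apply: val_inj.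
- exact: HT (inr r).
- apply: connect_trans Hz _; have := HS (inr (val r)).
  rewrite /= (region_class_inner (valP r)).
  by congr connect; congr inr; congr inr; apply: val_inj.
Qed.

(** With m points on the boundary of d, the insertion loses one disc, m regions
    and 2m ends of strings compared to the disjoint union of T and S, whose
    connected component S is absorbed by that of d. *)
Lemma glue_euler : @euler n U.
Proof.
have [[_ _ _ _ eT] [_ _ _ _ eS]] := (pT, pS).
rewrite /euler n_comp_glue; move: eT eS; rewrite /euler.
rewrite (n_comp_skeleton1 (fun x => collared_connected x cS)).
rewrite !card_sum !card_sig big_sumType /=.
have -> : #|[pred e | e != d]| = #|disc T|.-1 by rewrite -(cardC1 d); apply: eq_card.
have cc : #|codom (corner S None)| = arity T d.
  by rewrite (card_codom (collar_corner cS)) card_ord (prednK (collar_gt0 cS)).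
have -> : #|[pred r | ~~ [exists i, corner S None i == r]]| = #|region S| - arity T d.
  have := cardC (mem (codom (corner S None))); rewrite cc => <-; rewrite addKn.
  apply: eq_card => r; rewrite !inE; congr negb; apply/existsP/codomP; case=> i.
    by move/eqP => <-; exists i.
  by move->; exists i.
have rS : arity T d <= #|region S| by have := max_card (mem (codom (corner S None))); rewrite cc.
have dT : 0 < #|disc T| by apply/card_gt0P; exists d.
have -> : \sum_(e : {e | e != d}) arity T (sval e) = \sum_(e | e != d) arity T e.
  rewrite [RHS](reindex_omap (sval : {e | e != d} -> _) insub) => [|e ed]; last by rewrite insubT.
  by apply: eq_bigl => -[e ed] /=; rewrite insubT ed /= eqxx.
rewrite (bigD1 d) //=; move: rS dT.
move: (\sum_(i | i != d) _) (\sum_i _) (n_comp _ _) => a b c.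
by move: #|disc T| #|disc S| #|region T| #|region S| => e f g h; lia.
Qed.

Lemma glue_planar : planar U.
Proof.
split; [exact: glue_start_inj|exact: glue_ends|exact: glue_sides|exact: glue_cells|].
exact: glue_euler.
Qed.

End GluePlanar.

Definition glue_tangle n (T : tangle n) (d : disc T) (S : tangle (arity T d))
    (cS : collared S) : tangle n :=
  Tangle (glue_planar (tangle_planar T) (tangle_planar S) cS).

Lemma dfwith_id (I : eqType) (T : I -> Type) (f : forall i, T i) i :
  dfwith f (f i) = f.
Proof.
by apply: functional_extensionality_dep => j; case: dfwithP.
Qed.

Lemma act_glue_collared (R : realType) (P : planar_algebra R) n (T : tangle n)
    (d : disc T) (S : tangle (arity T d)) (cS : collared S)
    (x : forall e, P (arity T e)) (y : forall e, P (arity S e)) :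
  act y = x d -> @act R P n (glue_tangle cS) (@glue_label n T d S (fun k => P k) x y) = act x.
Proof.
move=> xd.
have [[_ _ sT _ _] [_ _ sS _ _]] := (tangle_planar T, tangle_planar S).
rewrite (@act_glue R P n T d S (glue_tangle cS) _ _ _ x y _
  (glue_is_glued cS sT sS)) ?xd ?dfwith_id //.
by case.
Qed.

(** * Reflection *)

Section Mirror.
Variables (n : nat) (T : pretangle n).

(** The points are numbered in the opposite direction starting from the same
    marked interval: corner 0 is fixed, and point 0 becomes the last one. *)
Definition mirror : pretangle n :=
  @PreTangle n (disc T) (arity T) (string T) (region T)
    (fun v i => start T v (rev_ord i))
    (fun o => left_of T (flip o))
    (fun v i => corner T v (inZp (varity n (arity T) v - i))).

Lemma incident_mirror v s : @incident _ mirror v s = @incident _ T v s.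
Proof.
apply/existsP/existsP => -[i /= si]; first by exists (rev_ord i).
by exists (rev_ord i); rewrite /= rev_ordK.
Qed.

Lemma skeleton_mirror : @skeleton n mirror =2 @skeleton n T.
Proof. by case=> [v|s] [w|t] //=; rewrite incident_mirror. Qed.

Lemma rev_corner m (i j : 'I_m.-1.+1) : (i + j) %% m = 0 -> inZp (m - j) = i.
Proof.
case: m i j => [|m] i j; first by rewrite (ord1 i) (ord1 j) => _; apply: val_inj.
move=> ij; apply: val_inj => /=.
have [lti ltj] : i < m.+1 /\ j < m.+1 by split; exact: ltn_ord.
have [j0|j0] := posnP j; first by move: ij; rewrite j0 addn0 subn0 modnn modn_small.
suff e : (i = m.+1 - j :> nat) by rewrite -e modn_small.
have [lt|ge] := ltnP (i + j) m.+1; first by move: ij; rewrite modn_small //; lia.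
have e : i + j = (i + j - m.+1) + m.+1 by lia.
by move: ij; rewrite e modnDr modn_small; lia.
Qed.

Lemma rev_cornerK m (i : 'I_m.-1.+1) :
  inZp (m - (inZp (m - i) : 'I_m.-1.+1)) = i :> 'I_m.-1.+1.
Proof.
apply: rev_corner => /=; case: m i => [|m] i; first by rewrite (ord1 i).
by rewrite modnDmr subnKC ?modnn //; exact/ltnW/ltn_ord.
Qed.

Lemma corner_mirror v i : corner T v i =
  corner mirror v (inZp (varity n (arity T) v - i)).
Proof.
by rewrite /= rev_cornerK.
Qed.

Hypothesis pT : planar T.

Lemma mirror_planar : planar mirror.
Proof.
have [injT endT [sT sT0] cT eT] := pT.
have cmod m (i : 'I_m) : inZp (rev_ord i).+1 = inZp (m - (inZp i : 'I_m.-1.+1)) :> 'I_m.-1.+1.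
  case: m i => [[]//|m] i; apply: val_inj => /=; rewrite (modn_small (ltn_ord i)).
  by congr (_ %% _); have := ltn_ord i; lia.
have cmodS m (i : 'I_m) : inZp (rev_ord i) = inZp (m - (inZp i.+1 : 'I_m.-1.+1)) :> 'I_m.-1.+1.
  case: m i => [[]//|m] i; apply: val_inj => /=; have lti := ltn_ord i.
  have [->|ltim] : i = m :> nat \/ i.+1 < m.+1 by lia.
    by rewrite modnn subn0 modnn subnn mod0n.
  by rewrite (modn_small ltim).
split.
- move=> [v i] [w j]; rewrite /start_point /= => E; have ev := start_vertex injT E.
  by move: i j E; rewrite -ev => i j /(start_index injT)/rev_ord_inj ->.
- move=> v i; have [w [j e_j]] := endT v (rev_ord i).
  by exists w, (rev_ord j); rewrite /= rev_ordK.
- split=> [d|] i; rewrite /= flipK.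
    by have [-> ->] := sT d (rev_ord i); rewrite cmod cmodS.
  by have [-> ->] := sT0 (rev_ord i); rewrite cmod cmodS.
- move=> x; apply: connect_sub (cT x) => a b ab; apply: connect1.
  have corn v r : [exists i, corner T v i == r] -> [exists i, corner mirror v i == r].
    by case/existsP=> i /eqP<-; apply/existsP; rewrite corner_mirror; eexists; exact: eqxx.
  have left s r : @cells n T (inl (inr s)) (inr r) -> @cells n mirror (inl (inr s)) (inr r).
    by move=> h; rewrite /= orbC; exact: h.
  case: a b ab => [[v|s]|r] [[w|t]|q] ab; try by [].
  + by rewrite /= incident_mirror.
  + exact: corn.
  + by rewrite /= incident_mirror.
  + exact: left.
  + exact: corn.
  + exact: left.
- by rewrite /euler /= (eq_n_comp (eq_connect skeleton_mirror)).
Qed.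

Lemma mirror_collared : collared T -> collared mirror.
Proof.
case=> m0 injs injc [c cc]; split=> //.
- by move=> i j /injs/rev_ord_inj.
- move=> i j /injc E; have := congr1 (fun l : 'I_n.-1.+1 => inZp (n - l) : 'I_n.-1.+1) E.
  by rewrite !rev_cornerK.
- exists c => x /cc; apply: connect_sub => a b ab; apply: connect1.
  by move: ab; rewrite /core /= skeleton_mirror.
Qed.

End Mirror.

Definition mirror_tangle n (T : tangle n) : tangle n :=
  Tangle (mirror_planar (tangle_planar T)).

Lemma act_mirror (R : realType) (P : planar_algebra R) n (T : tangle n)
    (x : forall e, P (arity T e)) :
  @act R P n (mirror_tangle T) (fun e => star (x e)) = star (act x).
Proof.
apply: (@act_star R P n T (mirror_tangle T) id id id x (fun e => star (x e))) => //.
split=> //; try by [exists id].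
- move=> [e|] i j /= ij; congr start; apply: val_inj => /=.
    by have := ltn_ord i; have := ltn_ord j; move: ij => /=; lia.
  by have := ltn_ord i; have := ltn_ord j; move: ij => /=; lia.
- by move=> [e|] i j /= ij; congr corner; exact: rev_corner.
Qed.

(** * Homeomorphisms determined by their effect on discs *)

(** Without closed loops and without regions bounded by such loops alone, every
    cell of a tangle can be named by a boundary point or a corner of a disc. *)
Definition filled n (T : pretangle n) : Prop :=
  (forall s, exists v, @incident n T v s) /\
  (forall r, exists v i, corner T v i = r).

Lemma filled_start n (T : pretangle n) : planar T -> filled T ->
  forall o, exists v i, start T v i = o.
Proof.
move=> [_ endT _ _ _] [fT _] [s c]; have [v /existsP[i /eqP]] := fT s.
case E: (start T v i) => [s' c'] /= es.
have [ec|ec] := eqVneq c c'; first by exists v, i; rewrite E es ec.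
have [w [j ej]] := endT v i; exists w, j; rewrite ej E es /flip /=.
by case: c c' ec {E} => [] [].
Qed.

Section Homeo.
Variables (n : nat) (T T' : pretangle n).
Variables (fd : disc T -> disc T') (fs : string T * bool -> string T' * bool).
Variable (fr : region T -> region T').
Hypotheses (pT : planar T) (pT' : planar T') (fT : filled T) (fT' : filled T').
Hypothesis fd_bij : bijective fd.
Hypothesis fd_arity : forall d, arity T' (fd d) = arity T d.
Hypothesis fs_flip : forall o, fs (flip o) = flip (fs o).
Hypothesis fs_start : forall v (i : 'I_(varity n (arity T) v))
    (j : 'I_(varity n (arity T') (omap fd v))),
  i = j :> nat -> start T' (omap fd v) j = fs (start T v i).
Hypothesis fr_corner : forall v (i : 'I_(varity n (arity T) v).-1.+1)
    (j : 'I_(varity n (arity T') (omap fd v)).-1.+1),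
  i = j :> nat -> corner T' (omap fd v) j = fr (corner T v i).

Let var v : varity n (arity T) v = varity n (arity T') (omap fd v).
Proof. by case: v => /=. Qed.

Let ofd_inj : injective (omap fd).
Proof. by move=> [d|] [e|] //= [] /(bij_inj fd_bij) ->. Qed.

Let ofd_surj w : exists v, omap fd v = w.
Proof.
have [g _ gK] := fd_bij.
by case: w => [w|]; [exists (Some (g w)); rewrite /= gK | exists None].
Qed.

Lemma homeo_fs_inj : injective fs.
Proof.
have [injT' _ _ _ _] := pT'.
move=> o o'; have [v [i <-]] := filled_start pT fT o.
have [w [j <-]] := filled_start pT fT o'.
rewrite -(fs_start (j := cast_ord (var v) i)) // -(fs_start (j := cast_ord (var w) j)) //.
move=> E; have /ofd_inj ev := start_vertex injT' E.
move: j E; rewrite -ev => j /(start_index injT') /(congr1 (@nat_of_ord _)) /=.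
by move/ord_inj->.
Qed.

Lemma homeo_fs_surj o' : exists o, fs o = o'.
Proof.
have [w [j <-]] := filled_start pT' fT' o'; have [v ev] := ofd_surj w.
move: j; rewrite -ev => j; exists (start T v (cast_ord (esym (var v)) j)).
by rewrite -(fs_start (j := j)).
Qed.

Let h (x : option (disc T) + string T) : option (disc T') + string T' :=
  match x with inl v => inl (omap fd v) | inr s => inr (fs (s, true)).1 end.

Let fs1 o : (fs o).1 = (fs (o.1, true)).1.
Proof. by case: o => s [] //; have := fs_flip (s, true); rewrite /flip /= => ->. Qed.

Let fs1_inj o o' : (fs o).1 = (fs o').1 -> o.1 = o'.1.
Proof.
move=> e; have [e2|e2] := eqVneq (fs o).2 (fs o').2.
  by congr fst; apply: homeo_fs_inj; rewrite [fs o]surjective_pairing e e2 -surjective_pairing.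
have /homeo_fs_inj -> // : fs o = fs (flip o').
rewrite fs_flip [fs o]surjective_pairing e /flip; congr pair.
by case: (fs o).2 (fs o').2 e2 => [] [].
Qed.

Lemma homeo_incident v s : @incident _ T' (omap fd v) (fs (s, true)).1 = @incident _ T v s.
Proof.
apply/existsP/existsP => -[i /eqP ei].
  exists (cast_ord (esym (var v)) i); apply/eqP.
  by move: ei; rewrite (fs_start (i := cast_ord (esym (var v)) i)) // => /fs1_inj.
by exists (cast_ord (var v) i); rewrite (fs_start (i := i)) // fs1 ei.
Qed.

(** fd and fs together form an isomorphism between the two graphs. *)
Lemma homeo_n_comp : n_comp (@skeleton n T') predT = n_comp (@skeleton n T) predT.
Proof.
have symT := sym_connect_sym (@skeleton_sym n T).
have symT' := sym_connect_sym (@skeleton_sym n T').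
rewrite (adjunction_n_comp h symT' symT (a := predT)) //.
apply: strict_adjunction => //.
- case=> [v|s] [w|t] //= []; first by move/ofd_inj ->.
  by move/fs1_inj => /= ->.
- apply/subsetP => -[v|s] _; apply/codomP.
    by have [w <-] := ofd_surj v; exists (inl w).
  by have [o eo] := homeo_fs_surj (s, true); exists (inr o.1); rewrite /= -fs1 eo.
- by case=> [v|s] [w|t] _ //=; exact: homeo_incident.
Qed.

(** Both tangles have the same discs, boundary points and components, so that
    Euler's formula gives them the same number of regions. *)
Lemma homeo_card_region : #|region T| = #|region T'|.
Proof.
have [_ _ _ _ eT] := pT; have [_ _ _ _ eT'] := pT'.
move: eT eT'; rewrite /euler homeo_n_comp -(bij_eq_card fd_bij).
rewrite [X in _ -> _ = _ + X + _ -> _](reindex fd) /=; last exact: onW_bij.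
under [X in _ -> _ = _ + X + _ -> _]eq_bigr => d _ do rewrite fd_arity.
by move=> <-; lia.
Qed.

Lemma homeo_fr_surj r' : exists r, fr r = r'.
Proof.
have [w [j <-]] := fT'.2 r'; have [v ev] := ofd_surj w.
move: j; rewrite -ev => j.
have e : (varity n (arity T') (omap fd v)).-1.+1 = (varity n (arity T) v).-1.+1.
  by rewrite -var.
by exists (corner T v (cast_ord e j)); rewrite -(fr_corner (j := j)).
Qed.

Lemma homeo_of_starts : tangle_homeo false fd fs fr.
Proof.
split=> //.
- have fin o' : exists o, fs o == o' by have [o <-] := homeo_fs_surj o'; exists o.
  pose g o' := xchoose (fin o').
  have gK o' : fs (g o') = o' by exact/eqP/(xchooseP (fin o')).
  by exists g => // o; apply: homeo_fs_inj; rewrite gK.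
- have fin r' : exists r, fr r == r' by have [r <-] := homeo_fr_surj r'; exists r.
  pose g r' := xchoose (fin r').
  have gK r' : fr (g r') = r' by exact/eqP/(xchooseP (fin r')).
  have /(inj_card_bij (can_inj gK)) [g' g'K gK'] : #|region T| <= #|region T'|.
    by rewrite homeo_card_region.
  by exists g => // r; rewrite -{1}(gK' r) gK gK'.
- move=> o; have [v [i <-]] := filled_start pT fT o.
  rewrite -(fs_start (j := cast_ord (var v) i)) //.
  have [[_ _ [sT sT0] _ _] [_ _ [sT' sT0'] _ _]] := (pT, pT').
  case: v i => [d|] i /=.
    have [-> _] := sT d i; have [-> _] := sT' (fd d) (cast_ord (var (Some d)) i).
    by apply: (fr_corner (v := Some d)); rewrite /= fd_arity.
  have [-> _] := sT0 i; have [-> _] := sT0' (cast_ord (var None) i).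
  exact: (fr_corner (v := None)).
Qed.

End Homeo.

Lemma mirror_filled n (T : pretangle n) : filled T -> filled (mirror T).
Proof.
case=> [sT rT]; split=> [s|r].
  by have [v] := sT s; rewrite -incident_mirror => iv; exists v.
by have [v [i <-]] := rT r; rewrite corner_mirror; eexists; eexists.
Qed.

Lemma glue_filled n (T : pretangle n) (d : disc T) (S : pretangle (arity T d)) :
  planar S -> collared S -> filled T -> filled S -> filled (glue T d S).
Proof.
move=> pS cS [sT rT] [sS rS]; split.
- case=> [s|s].
    have [v iv] := sT s; have [ed|vd] := eqVneq v (Some d).
      move: iv; rewrite ed => /existsP[i /eqP<-].
      by have [e ie] := glue_incident_d pS cS i; exists (Some (inr e)).
    by have [v' _ iv'] := @glue_incident _ _ _ S _ _ vd iv; exists v'.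
  have [[e|] iv] := sS (val s); last by have := valP s; rewrite /= iv.
  have /existsP[i /eqP ei] := iv; exists (Some (inr e)).
  apply/existsP; exists i; rewrite /= string_class_unoriented ei (string_class_inner _ (valP s)) /=.
  by apply/eqP; congr inr; apply: val_inj.
- case=> [r|r].
    have [[e|] [i <-]] := rT r; last by exists None, i.
    have [ed|ed] := eqVneq e d; last by exists (Some (inl (exist _ e ed))), i.
    move: i; rewrite ed => i; rewrite -(region_class_outer cS).
    have [_ _ [sS' sS0] _ _] := pS; have m0 := collar_gt0 cS.
    have lti : i < arity T d by rewrite -(prednK m0).
    have [f [j fj]] := outer_end pS cS (Ordinal lti).
    have [_ e2] := sS0 (Ordinal lti); have [e1 _] := sS' f j.
    exists (Some (inr f)), (inZp j); rewrite /= -e1 fj e2.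
    by congr (region_class (inr _)); congr corner; apply: valZpK.
  have [[e|] [i ei]] := rS (val r); last first.
    by have /existsP := valP r; case; exists i; rewrite ei.
  exists (Some (inr e)), i; rewrite /= ei (region_class_inner (valP r)).
  by congr inr; apply: val_inj.
Qed.

(** * Collars of the diagrams *)

Definition coattach_arity (k : nat) (d : bool) : nat := if d then 3 else k.+2.

(** The adjoint of attaching Y at the i-th point: the annular diagram of
    [attach_data] turned inside out, with Y (disc [true]) replaced by Y^*.
    Exchanging the two boundary circles and reflecting preserves the numbering
    of their points, and reverses the numbering of Y. *)
Definition coattach_data (k : nat) (i : 'I_k.+1) : pretangle k.+1 :=
  let A := attach_data i in
  @PreTangle k.+1 bool (coattach_arity k) (string A) (region A)
    (fun v => match v return 'I_(varity k.+1 (coattach_arity k) v) -> string A * bool with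
              | None => fun p => start A (Some false) p
              | Some false => fun p => start A None p
              | Some true => fun p => start A (Some true) (rev_ord p)
              end)
    (fun o => left_of A (flip o))
    (fun v => match v return 'I_(varity k.+1 (coattach_arity k) v).-1.+1 -> region A with
              | None => fun p => corner A (Some false) p
              | Some false => fun p => corner A None p
              | Some true => fun p => corner A (Some true) (inZp (3 - p))
              end).

Lemma core_connect_sym n (T : pretangle n) : connect_sym (@core n T).
Proof. by apply: sym_connect_sym => x y; rewrite /core skeleton_sym andbCA. Qed.

Lemma core_incident n (T : pretangle n) e s : @incident n T (Some e) s ->
  connect (@core n T) (inl (Some e)) (inr s).
Proof. by move=> es; apply: connect1. Qed.

Lemma core_start n (T : pretangle n) e (p : 'I_(arity T e)) :
  connect (@core n T) (inl (Some e)) (inr (start T (Some e) p).1).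
Proof. exact/core_incident/(@skeleton_start _ T (Some e)). Qed.

Section Attach.
Variables (k : nat) (i : 'I_k.+1).
Local Notation A := (attach_data i).
Local Notation C := (coattach_data i).

Lemma attach_incident v s : @incident _ C v s =
  @incident _ A (match v with None => Some false | Some false => None | _ => v end) s.
Proof.
case: v => [[]|] //; apply/existsP/existsP => -[p ep]; exists (rev_ord p) => //.
by case: p ep => [[|[|[|p]]] ltp].
Qed.

Lemma attach_filled : filled A.
Proof.
split=> [[j|b]|[j|]].
- by exists (Some false); apply/existsP; exists j => /=.
- exists (Some true); apply/existsP.
  by case: b; [exists (@Ordinal 3 2 isT) | exists (@Ordinal 3 1 isT)].
- by exists (Some false), j.
- by exists (Some true), (@Ordinal 3 2 isT).
Qed.

Lemma attach_core x : x != inl None -> connect (@core _ A) (inl (Some true)) x.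
Proof.
have st d p := @core_start _ A d p.
have cX : connect (@core _ A) (inl (Some true)) (inl (Some false)).
  apply: connect_trans (st true ord0) _; rewrite core_connect_sym.
  exact: st false i.
case: x => [[[]|]|[j|[]]] // _.
- exact: connect_trans cX (st false j).
- exact: (st true (@Ordinal 3 2 isT)).
- exact: (st true (@Ordinal 3 1 isT)).
Qed.

Lemma attach_collared : collared A.
Proof.
have [inj _ _ _ _] := attach_planar i.
split=> //; last by exists (inl (Some true)); exact: attach_core.
- move=> p q e; have E : start A None p = start A None q.
    move: e.
    by have [[j _]|[_]|[_]|[j _]] := attach_outer i p => /= ->;
      have [[l _]|[_]|[_]|[l _]] := attach_outer i q => /= -> //= ->.
  exact: start_index inj _ _ _ E.
- have lti := ltn_ord i; move=> p q; have /= ltp := ltn_ord p; have /= ltq := ltn_ord q.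
  rewrite /=; case: ifP => p1; [|case: eqP => p2]; (case: ifP => q1; [|case: eqP => q2]) => //;
    move=> E; apply: val_inj => /=; first [lia | case: E => /(congr1 val) /=; rewrite !inordK; lia].
Qed.

Lemma coattach_filled : filled C.
Proof.
have [sA rA] := attach_filled; split=> [s|r].
  have [v iv] := sA s.
  exists (match v with None => Some false | Some false => None | _ => v end).
  by rewrite attach_incident; case: v iv => [[]|].
have [[[]|] [p <-]] := rA r.
- by exists (Some true), (inZp (3 - p)); case: p => [[|[|[|p]]] ltp].
- by exists None, p.
- by exists (Some false), p.
Qed.

Lemma coattach_core x : x != inl None -> connect (@core _ C) (inl (Some true)) x.
Proof.
have Zi s : @incident _ A (Some true) s -> connect (@core _ C) (inl (Some true)) (inr s).
  by move=> h; apply: core_incident; rewrite attach_incident.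
have Xi s : @incident _ A None s -> connect (@core _ C) (inl (Some false)) (inr s).
  by move=> h; apply: core_incident; rewrite attach_incident.
have b1 : @incident _ A (Some true) (inr false).
  by apply/existsP; exists (@Ordinal 3 1 isT).
have b2 : @incident _ A (Some true) (inr true).
  by apply/existsP; exists (@Ordinal 3 2 isT).
have b0 : @incident _ A (Some true) (inl i) by apply/existsP; exists (@Ordinal 3 0 isT).
have lti := ltn_ord i.
have c1 : @incident _ A None (inr false).
  have lt : i < k.+2 by lia.
  by apply/existsP; exists (Ordinal lt); rewrite /= ltnn eqxx.
have cX : connect (@core _ C) (inl (Some true)) (inl (Some false)).
  by apply: connect_trans (Zi _ b1) _; rewrite core_connect_sym; exact: Xi.
case: x => [[[]|]|[j|[]]] // _.
- have [->|ji] := eqVneq j i; first exact: Zi.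
  apply: connect_trans cX (Xi _ _).
  have ltj := ltn_ord j.
  have nji : (j : nat) != i by [].
  apply/existsP; case: (ltnP j i) => ltji.
    have lt : j < k.+2 by lia.
    by exists (Ordinal lt); rewrite /= ltji inord_val.
  have lt : j.+1 < k.+2 by lia.
  by exists (Ordinal lt); rewrite /= !ifN ?inord_val //; lia.
- exact: Zi.
- exact: Zi.
Qed.

Lemma coattach_planar : planar C.
Proof.
have [injA endA [sA sA0] _ _] := attach_planar i.
pose f v : option bool := match v with None => Some false | Some false => None | _ => v end.
have SC v p : exists2 q : 'I_(varity k.+2 (attach_arity k) (f v)), start C v p = start A (f v) q
     & q = (if v == Some true then 2 - p else p) :> nat.
  by case: v p => [[]|] p; [exists (rev_ord p) | exists p | exists p].
have SA w q : exists v p, start C v p = start A w q.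
  case: w q => [[]|] q; last by exists (Some false), q.
    by exists (Some true), (rev_ord q); case: q => [[|[|[|q]]] ltq].
  by exists None, q.
have finj : injective f by move=> [[]|] [[]|].
have core0 := coattach_core.
apply: planar_connected.
- suff inj v w p q : start C v p = start C w q ->
      existT (fun v => 'I_(varity k.+1 (arity C) v)) v p = existT _ w q.
    by move=> [v p] [w q]; exact: inj.
  have [p' -> ep] := SC v p; have [q' -> eq] := SC w q => e.
  have /finj ev := start_vertex injA e.
  move: q q' e eq; rewrite -ev => q q' /(start_index injA) <-; rewrite ep => epq.
  congr existT; apply: val_inj => /=; move: epq; case: eqP => [e3|//].
  have v3 : varity k.+1 (arity C) v = 3 by rewrite e3.
  have [lp lq] : p < 3 /\ q < 3 by split; rewrite -v3; exact: ltn_ord.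
  by move: lp lq => /=; lia.
- move=> v p; have [p' -> _] := SC v p; have [w [q <-]] := endA (f v) p'.
  exact: SA.
- have flip2 o : left_of A (flip (flip o)) = left_of A o by rewrite flipK.
  split=> [[]|] p.
  + by case: p => [[|[|[|p]]] ltp].
  + by have [e1 e2] := sA0 p; split; [exact: e2 | exact: etrans (flip2 _) e1].
  + by have [e1 e2] := sA false p; split; [exact: e2 | exact: etrans (flip2 _) e1].
- move=> x; have [->|xN] := eqVneq x (inl None); first exact: connect0.
  have symC := sym_connect_sym (@skeleton_sym _ C).
  have cc y : y != inl None -> connect (@skeleton _ C) (inl (Some true)) y.
    by move/core0; apply: connect_sub => a b /and3P[_ _]; exact: connect1.
  apply: connect_trans (connect1 (@skeleton_start _ C None i)) _; rewrite symC.
  by apply: connect_trans (cc (inr _) isT); rewrite symC; exact: cc.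
- by have [_] := coattach_filled.
- by rewrite card_option card_bool card_ord big_bool /=; lia.
Qed.

Lemma coattach_collared : collared C.
Proof.
split=> //; last by exists (inl (Some true)); exact: coattach_core.
- by move=> p q [].
- by move=> p q [].
Qed.

End Attach.

Lemma transfer_filled k : filled (transfer_data k).
Proof.
split=> [[[j|j]|j]|[j|j]].
- by exists (Some None); apply/existsP; exists j => /=.
- by exists (Some (Some j)); apply/existsP; exists (@Ordinal 4 1 isT) => /=.
- by exists None; apply/existsP; exists j => /=.
- by exists (Some None), j.
- by exists None, j.
Qed.

Lemma transfer_collared k : collared (transfer_data k).
Proof.
split=> //; try by [move=> p q []].
exists (inl (Some None)).
have st d p := @core_start _ (transfer_data k) d p.
have cL a : connect (@core _ (transfer_data k)) (inl (Some None)) (inl (Some (Some a))).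
  apply: connect_trans (st None a) _; rewrite core_connect_sym.
  exact: st (Some a) (@Ordinal 4 2 isT).
move=> [[[a|]|]|[[a|a]|a]] // _.
- exact: st None a.
- exact: connect_trans (cL a) (st (Some a) (@Ordinal 4 1 isT)).
- exact: connect_trans (cL a) (st (Some a) (@Ordinal 4 0 isT)).
Qed.

Lemma bang_filled : filled bang_data.
Proof.
split=> [[[j|[[] []]]|]|[j|[]]].
- by exists None; apply/existsP; exists j => /=.
- by exists (Some (inl true)); apply/existsP; exists (@Ordinal 4 0 isT).
- by exists (Some (inl true)); apply/existsP; exists (@Ordinal 4 2 isT).
- by exists (Some (inl false)); apply/existsP; exists (@Ordinal 4 0 isT).
- by exists (Some (inl false)); apply/existsP; exists (@Ordinal 4 2 isT).
- by exists (Some (inl false)); apply/existsP; exists (@Ordinal 4 1 isT).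
- by exists None, j.
- by exists (Some (inl true)), (@Ordinal 4 0 isT).
- by exists (Some (inl true)), (@Ordinal 4 3 isT).
Qed.

Lemma bang_collared : collared bang_data.
Proof.
split=> //; try by [move=> p q []].
exists (inl (Some (inl false))).
have st d p := @core_start _ bang_data d p.
have ts d p : connect (@core _ bang_data) (inr (start bang_data (Some d) p).1) (inl (Some d)).
  by rewrite core_connect_sym.
have x m (lt : m < 4) := st (inl false) (Ordinal lt).
have cy := connect_trans (x 1 isT) (ts (inl true) (@Ordinal 4 3 isT)).
have y m (lt : m < 4) := connect_trans cy (st (inl true) (Ordinal lt)).
have cY := connect_trans (x 2 isT) (ts (inr false) (@Ordinal 3 1 isT)).
have cZ := connect_trans (x 0 isT) (ts (inr true) (@Ordinal 3 1 isT)).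
move=> [[[[]|[]]|]|[[p|[[] []]]|]] // _.
- rewrite (_ : p = inord p); last by rewrite inord_val.
  case: p => [[|[|[|[|p]]]] ltp] //=.
  + exact: connect_trans cZ (st (inr true) (@Ordinal 3 2 isT)).
  + exact: (y 1 isT).
  + exact: connect_trans cY (st (inr false) (@Ordinal 3 0 isT)).
  + exact: (x 3 isT).
- exact: (y 0 isT).
- exact: (y 2 isT).
- exact: (x 0 isT).
- exact: (x 2 isT).
- exact: (x 1 isT).
Qed.

Lemma inner_filled k : filled (inner_data k.+1).
Proof.
split=> r; last by exists (Some false), r.
by exists (Some false); apply/existsP; exists r => /=.
Qed.

Definition coattach_tangle k (i : 'I_k.+1) : tangle k.+1 := Tangle (coattach_planar i).

(** * Moving Y across the inner product *)

Section Adjoint.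
Variables (k : nat) (i : 'I_k.+1).
Local Notation A := (attach_data i).
Local Notation C := (coattach_data i).

Definition pairing_attach : tangle 0 :=
  @glue_tangle 0 (inner_tangle k.+2) true (mirror_tangle (attach_tangle i))
    (mirror_collared (attach_collared i)).

Definition pairing_coattach : tangle 0 :=
  @glue_tangle 0 (inner_tangle k.+1) false (coattach_tangle i) (coattach_collared i).

Local Notation gsa := (@string_class 0 (inner_data k.+2) true (mirror A)).
Local Notation gra := (@region_class 0 (inner_data k.+2) true (mirror A)).
Local Notation gsb := (@string_class 0 (inner_data k.+1) false C).
Local Notation grb := (@region_class 0 (inner_data k.+1) false C).

(** The first argument of the inner product fills the disc [false] of
    [coattach_data] on one side, and of [inner_data] on the other; the adjoint
    of the second one fills the disc [true] of [inner_data], or the disc [false]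
    of the reflected [attach_data]. *)
Definition pairing_disc (u : disc pairing_coattach) : disc pairing_attach :=
  match u with
  | inl _ => inr false
  | inr false => inl (exist _ false isT)
  | inr true => inr true
  end.

(** The strings of [inner_data] are oriented away from its disc [false], and
    enter the adjoint of the second argument; those of [attach_data] leave it. *)
Definition pairing_string (o : string pairing_coattach * bool) :
    string pairing_attach * bool :=
  match o with
  | (inl j, c) => gsa (inr (inl j, ~~ c))
  | (inr s, c) => gsa (inr (val s, c))
  end.

Definition pairing_region (r : region pairing_coattach) : region pairing_attach :=
  match r with
  | inl r => gra (inr (Some r))
  | inr r => gra (inr (val r))
  end.

Lemma pairing_string_inr o : pairing_string (gsb (inr o)) = gsa (inr o).
Proof.
have [[h ->]|[p ->]|[p ->]] := @string_cases _ (inner_data k.+1) false C o.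
- by rewrite [in RHS](surjective_pairing o).
- by rewrite (@string_class_outer _ (inner_data k.+1) false C (coattach_collared i)).
- by rewrite string_class_flipr (@string_class_outer _ (inner_data k.+1) false C (coattach_collared i)).
Qed.

Lemma pairing_region_inr r : pairing_region (grb (inr r)) = gra (inr r).
Proof.
have /orP[/existsP[p /eqP<-]|h] := orbN [exists p, corner C None p == r].
  by rewrite (@region_class_outer _ (inner_data k.+1) false C (coattach_collared i)).
by rewrite (@region_class_inner _ (inner_data k.+1) false C r h).
Qed.

Lemma pairing_start v (p : 'I_(varity 0 (arity pairing_coattach) v))
    (q : 'I_(varity 0 (arity pairing_attach) (omap pairing_disc v))) :
  p = q :> nat ->
  start pairing_attach (omap pairing_disc v) q = pairing_string (start pairing_coattach v p).
Proof.
have cM := mirror_collared (attach_collared i).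
case: v p q => [[[[] e]|[]]|] p q pq;
  [|case: (notF e)| | |case: p q pq => m ltm; case: (notF ltm)].
- apply: (congr1 (fun l => gsa (inr (inl l, true)))); apply: val_inj.
  by move: pq => /= ->.
- transitivity (gsa (inr (start C (Some true) p))); last by rewrite -pairing_string_inr.
  by congr (gsa (inr _)); congr start; apply: val_inj; rewrite /= pq.
- transitivity (gsa (inr (start C (Some false) p))); last by rewrite -pairing_string_inr.
  move: p q pq; rewrite /= => p q pq.
  have := @string_class_outer _ (inner_data k.+2) true (mirror A) cM (rev_ord q).
  have -> : flip (start (inner_data k.+2) (Some true) (rev_ord q)) = (q, true).
    by rewrite /= rev_ordK.
  move=> <-; congr (gsa (inr _)).
  rewrite (_ : p = q); last exact: val_inj.
  by rewrite -[in RHS](rev_ordK q).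
Qed.

Lemma pairing_corner v (p : 'I_(varity 0 (arity pairing_coattach) v).-1.+1)
    (q : 'I_(varity 0 (arity pairing_attach) (omap pairing_disc v)).-1.+1) :
  p = q :> nat ->
  corner pairing_attach (omap pairing_disc v) q = pairing_region (corner pairing_coattach v p).
Proof.
have cM := mirror_collared (attach_collared i).
have outer q' : inl q' = gra (inr (corner A None q')).
  have := @region_class_outer _ (inner_data k.+2) true (mirror A) cM (inZp (k.+2 - q')).
  have -> : corner (inner_data k.+2) (Some true) (inZp (k.+2 - q')) = q'.
    exact: (@rev_cornerK k.+2).
  by move <-; exact: (congr1 (fun l => gra (inr (corner A None l))) (@rev_cornerK k.+2 q')).
case: v p q => [[[[] e]|[]]|] p q pq; [|case: (notF e)| | |].
- move: p q pq; rewrite /= => p q pq; congr (gra (inr (Some _))).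
  by apply: val_inj; rewrite /= pq.
- transitivity (gra (inr (corner C (Some true) p))); last by rewrite -pairing_region_inr.
  by congr (gra (inr _)); congr corner; apply: val_inj; rewrite /= pq.
- transitivity (gra (inr (corner C (Some false) p))); last by rewrite -pairing_region_inr.
  move: p q pq; rewrite /= => p q pq; rewrite (_ : p = q); last exact: val_inj.
  exact: outer.
- apply: etrans (outer ord0) _; apply: (congr1 (fun r => gra (inr r))).
  by congr Some; apply: val_inj; rewrite /= inordK.
Qed.

Lemma pairing_disc_bij : bijective pairing_disc.
Proof.
exists (fun u : disc pairing_attach => match u with
  | inl _ => inr false
  | inr false => inl (exist (fun b : bool => b != false) true isT)
  | inr true => inr true end : disc pairing_coattach).
- by move=> [[[] e]|[]] //; congr inl; apply: val_inj.
- by move=> [[[] e]|[]] //; congr inl; apply: val_inj.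
Qed.

Lemma pairing_homeo :
  tangle_homeo false pairing_disc pairing_string pairing_region.
Proof.
have [pa pb] := (tangle_planar pairing_attach, tangle_planar pairing_coattach).
apply: homeo_of_starts pb pa _ _ pairing_disc_bij _ _ pairing_start pairing_corner.
- exact: (@glue_filled _ (inner_data k.+1) false C) (coattach_planar i)
    (coattach_collared i) (inner_filled k) (coattach_filled i).
- exact: (@glue_filled _ (inner_data k.+2) true (mirror A))
    (mirror_planar (attach_planar i)) (mirror_collared (attach_collared i))
    (inner_filled k.+1) (mirror_filled (attach_filled i)).
- by move=> [[[] e]|[]].
- move=> [[s|s] c].
    exact: (@string_class_flipr _ (inner_data k.+2) true (mirror A) (inl s, ~~ c)).
  exact: (@string_class_flipr _ (inner_data k.+2) true (mirror A) (val s, c)).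
Qed.

End Adjoint.

Section Algebra.
Variables (R : realType) (P : planar_algebra R).

Definition coattach (Z : P 3) k (i : 'I_k.+1) (z : P k.+2) : P k.+1 :=
  @act R P k.+1 (coattach_tangle i)
    (fun b : bool => match b return P (coattach_arity k b) with
                     | false => z | true => Z end).

(** Both sides are values of one closed diagram, with discs z, e^* and Y^*. *)
Lemma inner_attach (Y : P 3) k (i : 'I_k.+1) (z : P k.+2) (e : P k.+1) :
  inner z (attach Y i e) = inner (coattach (star Y) i z) e.
Proof.
rewrite /inner; congr Defs.scalar.
pose x (b : bool) : P k.+2 := if b then star (attach Y i e) else z.
pose x' (b : bool) : P k.+1 := if b then star e else coattach (star Y) i z.
transitivity (@act R P 0 (inner_tangle k.+2) x); first by [].
transitivity (@act R P 0 (inner_tangle k.+1) x'); last by [].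
pose y (b : bool) := match b return P (attach_arity k b) with false => e | true => Y end.
rewrite -(@act_glue_collared R P 0 (inner_tangle k.+2) true (mirror_tangle (attach_tangle i))
  (mirror_collared (attach_collared i)) x (fun b => star (y b))); last exact: act_mirror.
rewrite -(@act_glue_collared R P 0 (inner_tangle k.+1) false (coattach_tangle i)
  (coattach_collared i) x' (fun b : bool => match b return P (coattach_arity k b) with
                     | false => z | true => star Y end)) //.
apply: act_isotopy (pairing_homeo i) _.
by move=> [[[] h]|[]].
Qed.

End Algebra.

(** * Fusing two elements of a ring *)

Lemma ord_congr m (B : Type) (f g : 'I_m -> B) : f =1 g ->
  forall p q : 'I_m, p = q :> nat -> f q = g p.
Proof. by move=> fg p q /ord_inj ->. Qed.

Section Branching.
Variables (k : nat) (i : 'I_k.+1).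
Local Notation A := (attach_data i).
Local Notation C := (coattach_data i).

(** Branching at i moves the j-th leaf to [left_leaf j] = [right_leaf j] when
    j <> i; the children of the i-th leaf are [left_leaf i] and [right_leaf i]. *)
Definition left_leaf (j : 'I_k.+1) : 'I_k.+2 := lift (inord i.+1) j.
Definition right_leaf (j : 'I_k.+1) : 'I_k.+2 := lift (inord i) j.
Local Arguments left_leaf : simpl never.
Local Arguments right_leaf : simpl never.
Local Notation l := left_leaf.
Local Notation r := right_leaf.

Let lti : i < k.+1. Proof. exact: ltn_ord. Qed.

Lemma left_leafE j : l j = (i < j) + j :> nat.
Proof. by rewrite /left_leaf /= /bump inordK. Qed.

Lemma right_leafE j : r j = (i <= j) + j :> nat.
Proof. by rewrite /right_leaf /= /bump inordK // ltnW. Qed.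

Lemma left_right_leaf j : j != i -> l j = r j.
Proof.
move=> ji; have nji : (j : nat) != i by [].
by apply: ord_inj; rewrite left_leafE right_leafE; lia.
Qed.

Lemma ordS_right_leaf j : ordS (r j) = l (ordS j).
Proof.
apply: ord_inj; transitivity ((r j : nat).+1 %% k.+2) => //; rewrite left_leafE right_leafE /=.
have ltj := ltn_ord j; have [e|ltjk] : j = k :> nat \/ j.+1 < k.+1 by lia.
  have -> : i <= j by lia.
  by rewrite e /= add1n !modnn.
by rewrite (modn_small ltjk) modn_small; lia.
Qed.

Lemma ordS_left_leaf : ordS (l i) = r i.
Proof.
apply: ord_inj; transitivity ((l i : nat).+1 %% k.+2) => //; rewrite left_leafE right_leafE ltnn leqnn.
by rewrite modn_small.
Qed.

Lemma ord_pred_left_leaf j : ord_pred (l j) = r (ord_pred j).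
Proof. by rewrite -[j in LHS]ord_predK -ordS_right_leaf ordSK. Qed.

Lemma ord_pred_right_leaf : ord_pred (r i) = l i.
Proof. by rewrite -ordS_left_leaf ordSK. Qed.

Let startE (p : 'I_k.+2) : start A None p =
  if p < i then (inl (inord p), false)
  else if p == i :> nat then (inr false, false)
  else if p == i.+1 :> nat then (inr true, false) else (inl (inord p.-1), false).
Proof. by []. Qed.

Let cornerE (p : 'I_k.+2) : corner A None p =
  if p <= i then Some (inord p)
  else if p == i.+1 :> nat then None else Some (inord p.-1).
Proof. by []. Qed.

Lemma attach_left_leaf j :
  start A None (l j) = (if j == i then (inr false, false) else (inl j, false)).
Proof.
have E := left_leafE j; have ltj := ltn_ord j.
case: (eqVneq j i) => [ji|ji].
  by move: E; rewrite ji ltnn add0n startE => ->; rewrite ltnn eqxx.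
have nji : (j : nat) != i by [].
rewrite startE E; case: (ltnP i j) => lij.
  by rewrite !ifN ?add1n ?inord_val //; lia.
by rewrite ifT ?inord_val //; lia.
Qed.

Lemma attach_right_leaf : start A None (r i) = (inr true, false).
Proof. by rewrite startE right_leafE leqnn add1n eqxx !ifN //; lia. Qed.

Lemma corner_left_leaf j : corner A None (l j) = Some j.
Proof.
have E := left_leafE j; have ltj := ltn_ord j.
rewrite cornerE E; case: (ltnP i j) => lij.
  by rewrite !ifN ?add1n ?inord_val //; lia.
by rewrite ifT ?add0n ?inord_val //; lia.
Qed.

Lemma corner_right_leaf : corner A None (r i) = None.
Proof. by rewrite cornerE right_leafE leqnn add1n eqxx ifN //; lia. Qed.

Local Notation T := (transfer_data k).
Local Notation T' := (transfer_data k.+1).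

(** The ring is put into the annular diagram around it before its inner disc is
    filled: in this order only elementary diagrams are ever inserted, and only
    these need a collar. *)
Definition capped_ring : tangle k.+1 :=
  @glue_tangle k.+1 (coattach_tangle i) false (transfer_tangle k.+1)
    (transfer_collared k.+1).

Definition branched_ring : tangle k.+1 :=
  @glue_tangle k.+1 capped_ring (inr None) (attach_tangle i) (attach_collared i).

Definition fused_ring : tangle k.+1 :=
  @glue_tangle k.+1 (transfer_tangle k) (Some i) bang_tangle bang_collared.

Local Notation gso := (@string_class k.+1 C false T').
Local Notation gro := (@region_class k.+1 C false T').
Local Notation gsd := (@string_class k.+1 capped_ring (inr None) A).
Local Notation grd := (@region_class k.+1 capped_ring (inr None) A).
Local Notation gse := (@string_class k.+1 T (Some i) bang_data).
Local Notation gre := (@region_class k.+1 T (Some i) bang_data).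

Definition ring_disc (j : 'I_k.+2) : disc branched_ring :=
  inl (exist (fun e : disc capped_ring => e != inr None) (inr (Some j)) isT).

Definition branch_disc (u : disc fused_ring) : disc branched_ring :=
  match u with
  | inl e => if val e is Some j then ring_disc (l j) else inr false
  | inr (inl b) => ring_disc (if b then r i else l i)
  | inr (inr false) => inr true
  | inr (inr true) => inl (exist (fun e : disc capped_ring => e != inr None)
      (inl (exist (fun b : bool => b != false) true isT)) isT)
  end.

(** The cells of [branched_ring] coming from [attach_data] (inside the ring), from
    the ring, and from [coattach_data] (outside). *)
Definition in_string (o : string A * bool) : string branched_ring * bool := gsd (inr o).
Definition ring_string (o : string T' * bool) : string branched_ring * bool :=
  gsd (inl (gso (inr o))).
Definition out_string (o : string C * bool) : string branched_ring * bool :=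
  gsd (inl (gso (inl o))).

Definition in_region (r : region A) : region branched_ring := grd (inr r).
Definition ring_region (r : region T') : region branched_ring := grd (inl (gro (inr r))).
Definition out_region (r : region C) : region branched_ring := grd (inl (gro (inl r))).

(** The radial strings and the regions of the ring are continued by cells inside
    or outside of it; this and the next three equations say by which. *)
Lemma ring_string_outer q : ring_string (inr q, true) = out_string (start A None q).
Proof.
rewrite /ring_string /out_string; congr (gsd (inl _)).
have := @string_class_outer _ C false T' (transfer_collared k.+1) q.
by move/(congr1 (@flip _)); rewrite -string_class_flipr -string_class_flipl flipK.
Qed.

Lemma ring_string_inner q : ring_string (inl (inl q), false) = in_string (start A None q).
Proof.
have := @string_class_outer _ capped_ring (inr None) A (attach_collared i) q.
move=> E; rewrite /in_string E; congr (gsd (inl _)).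
exact: (@string_class_flipr _ C false T' (inl (inl q), true)).
Qed.

Lemma ring_region_outer q : ring_region (inr q) = out_region (corner A None q).
Proof.
congr (grd (inl _)).
exact: (@region_class_outer _ C false T' (transfer_collared k.+1) q).
Qed.

Lemma ring_region_inner q : ring_region (inl q) = in_region (corner A None q).
Proof.
by rewrite /in_region (@region_class_outer _ capped_ring (inr None) A (attach_collared i) q).
Qed.

(** After branching, the ring string from the j-th element to the next one starts
    at the last child of the j-th leaf. *)
Definition branch_string_T (o : string T * bool) : string branched_ring * bool :=
  match o with
  | (inl (inl j), c) => in_string (inl j, c)
  | (inl (inr j), c) => ring_string (inl (inr (r j)), c)
  | (inr j, c) => out_string (inl j, ~~ c)
  end.

(** The value at a leg is forced by the string of the ring which continues it.
    The strings joining x and y to Y and Y^* are oriented away from x and y in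
    [bang_data], and away from Y and Y^* in [attach_data] and [coattach_data]. *)
Definition branch_string_bang (o : bang_string * bool) : string branched_ring * bool :=
  match o with
  | (None, c) => ring_string (inl (inr (l i)), c)
  | (Some (inr (p, false)), c) => in_string (inr p, ~~ c)
  | (Some (inr (p, true)), c) => out_string (inr p, ~~ c)
  | (Some (inl q), c) =>
      let t := start T (Some (Some i)) q in branch_string_T (t.1, t.2 (+) ~~ c)
  end.

Definition branch_string (o : string fused_ring * bool) : string branched_ring * bool :=
  match o with
  | (inl s, c) => branch_string_T (s, c)
  | (inr s, c) => branch_string_bang (val s, c)
  end.

Definition branch_region_T (q : region T) : region branched_ring :=
  match q with inl j => in_region (Some j) | inr j => out_region (Some j) end.

Definition branch_region_bang (q : region bang_data) : region branched_ring :=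
  match q with
  | inl q => branch_region_T (corner T (Some (Some i)) q)
  | inr false => in_region None
  | inr true => out_region None
  end.

Definition branch_region (q : region fused_ring) : region branched_ring :=
  match q with
  | inl q => branch_region_T q
  | inr q => branch_region_bang (val q)
  end.

Lemma in_string_flip o : in_string (flip o) = flip (in_string o).
Proof. exact: string_class_flipr. Qed.

Lemma ring_string_flip o : ring_string (flip o) = flip (ring_string o).
Proof. by rewrite /ring_string string_class_flipr. Qed.

Lemma branch_string_T_flip o : branch_string_T (flip o) = flip (branch_string_T o).
Proof.
case: o => [[[j|j]|j] c]; first exact: (in_string_flip (inl j, c)).
  exact: (ring_string_flip (inl (inr (r j)), c)).
by [].
Qed.

Lemma branch_string_bang_flip o : branch_string_bang (flip o) = flip (branch_string_bang o).
Proof.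
case: o => [[[q|[p []]]|] c].
- rewrite /branch_string_bang /flip -[RHS]branch_string_T_flip.
  by congr branch_string_T; rewrite /flip; congr pair; case: (_.2) c => [] [].
- by [].
- exact: (in_string_flip (inr p, ~~ c)).
- exact: (ring_string_flip (inl (inr (l i)), c)).
Qed.

Lemma branch_string_flip o : branch_string (flip o) = flip (branch_string o).
Proof.
case: o => [[s|s] c]; first exact: (branch_string_T_flip (s, c)).
exact: (branch_string_bang_flip (val s, c)).
Qed.

Lemma branch_string_inr o : branch_string (gse (inr o)) = branch_string_bang o.
Proof.
have out q : branch_string (gse (inr (start bang_data None q))) =
    branch_string_bang (start bang_data None q).
  rewrite (@string_class_outer _ T (Some i) bang_data bang_collared).
  rewrite /branch_string_bang [start bang_data None q]/=.
  by congr branch_string_T; congr pair; rewrite addbT.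
have [[h ->]|[q ->]|[q ->]] := @string_cases _ T (Some i) bang_data o.
- by rewrite [in RHS](surjective_pairing o).
- exact: out.
- by rewrite string_class_flipr branch_string_flip out -branch_string_bang_flip.
Qed.

Lemma branch_region_inr q : branch_region (gre (inr q)) = branch_region_bang q.
Proof.
have /orP[/existsP[p /eqP<-]|h] := orbN [exists p, corner bang_data None p == q].
  by rewrite (@region_class_outer _ T (Some i) bang_data bang_collared).
by rewrite (@region_class_inner _ T (Some i) bang_data q h).
Qed.

Lemma branch_string_inl t : branch_string (gse (inl t)) = branch_string_T t.
Proof. by case: t. Qed.

Lemma branch_start_ring j (p q : 'I_4) : j != i -> p = q :> nat ->
  ring_string (start T' (Some (Some (l j))) q) =
  branch_string_T (start T (Some (Some j)) p).
Proof.
move=> ji /ord_inj ->.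
have := ring_string_outer (l j); have := ring_string_inner (l j).
rewrite attach_left_leaf (negbTE ji) => inE outE.
case: q => [[|[|[|[|q]]]] ltq]; last by [].
- exact: outE.
- exact: (congr1 (fun m => ring_string (inl (inr m), true)) (left_right_leaf ji)).
- exact: inE.
- exact: (congr1 (fun m => ring_string (inl (inr m), false)) (ord_pred_left_leaf j)).
Qed.

Lemma branch_start_bang b (p q : 'I_4) : p = q :> nat ->
  ring_string (start T' (Some (Some (if b then r i else l i))) q) =
  branch_string_bang (start bang_data (Some (inl b)) p).
Proof.
move=> /ord_inj ->.
have ring m m' c : m = m' -> ring_string (inl (inr m), c) = ring_string (inl (inr m'), c).
  by move->.
case: b.
  have := ring_string_outer (r i); have := ring_string_inner (r i).
  rewrite attach_right_leaf => inE outE.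
  case: q => [[|[|[|[|q]]]] ltq]; last by [].
  - exact: outE.
  - by rewrite [start bang_data _ _]/= /bang_leg /= inordK.
  - exact: inE.
  - exact: ring ord_pred_right_leaf.
have := ring_string_outer (l i); have := ring_string_inner (l i).
rewrite attach_left_leaf eqxx => inE outE.
case: q => [[|[|[|[|q]]]] ltq]; last by [].
- exact: outE.
- by [].
- exact: inE.
- rewrite [start bang_data _ _]/= /bang_leg /= inordK //=.
  exact: ring (ord_pred_left_leaf i).
Qed.

Lemma branch_start_Y (p q : 'I_3) : p = q :> nat ->
  in_string (start A (Some true) q) = branch_string_bang (start bang_data (Some (inr false)) p).
Proof.
move=> /ord_inj ->; case: q => [[|[|[|q]]] ltq]; try by [].
by rewrite [start bang_data _ _]/= /bang_leg /= inordK.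
Qed.

Lemma branch_start_Z (p q : 'I_3) : p = q :> nat ->
  out_string (start C (Some true) q) = branch_string_bang (start bang_data (Some (inr true)) p).
Proof.
move=> /ord_inj ->; case: q => [[|[|[|q]]] ltq]; try by [].
by rewrite [start bang_data _ _]/= /bang_leg /= inordK.
Qed.

Lemma start_branched_ring j q : start branched_ring (Some (ring_disc j)) q =
  ring_string (start T' (Some (Some j)) q).
Proof. rewrite /ring_string; reflexivity. Qed.

Lemma start_branched_in e q : start branched_ring (Some (inr e)) q =
  in_string (start A (Some e) q).
Proof. rewrite /in_string; reflexivity. Qed.

Lemma start_branched_out q : start branched_ring (Some (branch_disc (inr (inr true)))) q =
  out_string (start C (Some true) q).
Proof. rewrite /out_string; reflexivity. Qed.

Lemma start_branched_outer q : start branched_ring None q =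
  out_string (start C None q).
Proof. rewrite /out_string; reflexivity. Qed.

Lemma branch_start v (p : 'I_(varity k.+1 (arity fused_ring) v))
    (q : 'I_(varity k.+1 (arity branched_ring) (omap branch_disc v))) :
  p = q :> nat ->
  start branched_ring (omap branch_disc v) q = branch_string (start fused_ring v p).
Proof.
case: v p q => [[[[j|] e]|[b|[]]]|] p q pq.
- apply: etrans (start_branched_ring _) _.
  exact: etrans (branch_start_ring (p := p) e pq) (esym (branch_string_inl _)).
- apply: etrans (start_branched_in (e := false) _) _.
  apply: etrans (esym (branch_string_inl (inl (inl p), true))).
  exact: (@ord_congr _ _ (fun q => in_string (inl q, true)) (fun q => in_string (inl q, true))
    (fun p => erefl) p q pq).
- apply: etrans (start_branched_ring _) _.
  exact: etrans (branch_start_bang b (p := p) pq) (esym (branch_string_inr _)).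
- apply: etrans (start_branched_out _) _.
  exact: etrans (branch_start_Z (p := p) pq) (esym (branch_string_inr _)).
- apply: etrans (start_branched_in (e := true) _) _.
  exact: etrans (branch_start_Y (p := p) pq) (esym (branch_string_inr _)).
- apply: etrans (start_branched_outer _) _.
  apply: etrans (esym (branch_string_inl (inr p, false))).
  exact: (@ord_congr _ _ (fun q => out_string (inl q, true)) (fun q => out_string (inl q, true))
    (fun p => erefl) p q pq).
Qed.

Lemma branch_region_inl q : branch_region (gre (inl q)) = branch_region_T q.
Proof. by []. Qed.

Lemma branch_corner_ring j (p q : 'I_4) : j != i -> p = q :> nat ->
  ring_region (corner T' (Some (Some (l j))) q) =
  branch_region_T (corner T (Some (Some j)) p).
Proof.
move=> ji /ord_inj ->.
have outE := ring_region_outer (l j); have inE := ring_region_inner (l j).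
have outES := ring_region_outer (l (ordS j)); have inES := ring_region_inner (l (ordS j)).
rewrite !corner_left_leaf -ordS_right_leaf -left_right_leaf // in outE inE outES inES.
by case: q => [[|[|[|[|q]]]] ltq]; [exact: outE|exact: outES|exact: inES|exact: inE|].
Qed.

Lemma branch_corner_bang b (p q : 'I_4) : p = q :> nat ->
  ring_region (corner T' (Some (Some (if b then r i else l i))) q) =
  branch_region_bang (corner bang_data (Some (inl b)) p).
Proof.
move=> /ord_inj ->.
have outR := ring_region_outer (r i); have inR := ring_region_inner (r i).
rewrite corner_right_leaf in outR inR.
case: b.
  have outS := ring_region_outer (l (ordS i)); have inS := ring_region_inner (l (ordS i)).
  rewrite !corner_left_leaf -ordS_right_leaf in outS inS.
  case: q => [[|[|[|[|q]]]] ltq]; last by [].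
  - exact: outR.
  - by rewrite [corner bang_data _ _]/= /branch_region_bang /= inordK //; exact: outS.
  - by rewrite [corner bang_data _ _]/= /branch_region_bang /= inordK //; exact: inS.
  - exact: inR.
have outL := ring_region_outer (l i); have inL := ring_region_inner (l i).
rewrite !corner_left_leaf in outL inL; rewrite -ordS_left_leaf in outR inR.
case: q => [[|[|[|[|q]]]] ltq]; last by [].
- by rewrite [corner bang_data _ _]/= /branch_region_bang /= inordK //; exact: outL.
- exact: outR.
- exact: inR.
- by rewrite [corner bang_data _ _]/= /branch_region_bang /= inordK //; exact: inL.
Qed.

Lemma branch_corner_Y (p q : 'I_3) : p = q :> nat ->
  in_region (corner A (Some true) q) = branch_region_bang (corner bang_data (Some (inr false)) p).
Proof.
move=> /ord_inj ->; case: q => [[|[|[|q]]] ltq]; try by [].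
  by rewrite [corner bang_data _ _]/= /branch_region_bang /= inordK.
by rewrite [corner bang_data _ _]/= /branch_region_bang /= inordK.
Qed.

Lemma branch_corner_Z (p q : 'I_3) : p = q :> nat ->
  out_region (corner C (Some true) q) = branch_region_bang (corner bang_data (Some (inr true)) p).
Proof.
move=> /ord_inj ->; case: q => [[|[|[|q]]] ltq]; try by [].
  by rewrite [corner bang_data _ _]/= /branch_region_bang /= inordK.
by rewrite [corner bang_data _ _]/= /branch_region_bang /= inordK.
Qed.

Lemma corner_branched_ring j q : corner branched_ring (Some (ring_disc j)) q =
  ring_region (corner T' (Some (Some j)) q).
Proof. rewrite /ring_region; reflexivity. Qed.

Lemma corner_branched_in e q : corner branched_ring (Some (inr e)) q =
  in_region (corner A (Some e) q).
Proof. rewrite /in_region; reflexivity. Qed.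

Lemma corner_branched_out q : corner branched_ring (Some (branch_disc (inr (inr true)))) q =
  out_region (corner C (Some true) q).
Proof. rewrite /out_region; reflexivity. Qed.

Lemma corner_branched_outer q : corner branched_ring None q =
  out_region (corner C None q).
Proof. rewrite /out_region; reflexivity. Qed.

Lemma branch_corner v (p : 'I_(varity k.+1 (arity fused_ring) v).-1.+1)
    (q : 'I_(varity k.+1 (arity branched_ring) (omap branch_disc v)).-1.+1) :
  p = q :> nat ->
  corner branched_ring (omap branch_disc v) q = branch_region (corner fused_ring v p).
Proof.
case: v p q => [[[[j|] e]|[b|[]]]|] p q pq.
- apply: etrans (corner_branched_ring _) _.
  exact: etrans (branch_corner_ring (p := p) e pq) (esym (branch_region_inl _)).
- apply: etrans (corner_branched_in (e := false) _) _.
  apply: etrans (esym (branch_region_inl (inl p))).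
  exact: (@ord_congr _ _ (fun q => in_region (Some q)) (fun q => in_region (Some q))
    (fun p => erefl) p q pq).
- apply: etrans (corner_branched_ring _) _.
  exact: etrans (branch_corner_bang b (p := p) pq) (esym (branch_region_inr _)).
- apply: etrans (corner_branched_out _) _.
  exact: etrans (branch_corner_Z (p := p) pq) (esym (branch_region_inr _)).
- apply: etrans (corner_branched_in (e := true) _) _.
  exact: etrans (branch_corner_Y (p := p) pq) (esym (branch_region_inr _)).
- apply: etrans (corner_branched_outer _) _.
  apply: etrans (esym (branch_region_inl (inr p))).
  exact: (@ord_congr _ _ (fun q => out_region (Some q)) (fun q => out_region (Some q))
    (fun p => erefl) p q pq).
Qed.

Lemma branch_disc_inj : injective branch_disc.
Proof.
have lr j : l j <> r i.
  by move/(congr1 (@nat_of_ord _)); rewrite left_leafE right_leafE leqnn; lia.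
have ring_inj j j' : ring_disc j = ring_disc j' -> j = j' by case.
case=> [[[j|] e]|[b|[]]] [[[j'|] e']|[b'|[]]] //.
- by move/ring_inj/lift_inj => ejj; congr inl; apply: val_inj; rewrite /= ejj.
- case: b' => /ring_inj; first by move/lr.
  by move/lift_inj => ji; case/eqP: (e); rewrite ji.
- by move=> _; congr inl; apply: val_inj.
- case: b => /ring_inj; first by move/esym/lr.
  by move/lift_inj => ji; case/eqP: (e'); rewrite ji.
- by case: b b' => [] [] // /ring_inj; [move/esym/lr|move/lr].
Qed.

Lemma branch_disc_bij : bijective branch_disc.
Proof.
have cardD1 (D : finType) (d : D) : #|[pred e | e != d]| = #|D|.-1.
  by rewrite -(cardC1 d); apply: eq_card.
apply: inj_card_bij branch_disc_inj _.
have -> : #|disc branched_ring| = (#|{: bool}|.-1 + #|{: option 'I_k.+2}|).-1 + #|{: bool}|.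
  rewrite card_sum card_sig; congr (_ + _); apply: etrans (cardD1 _ _) _.
  by rewrite card_sum card_sig; congr (_ + _).-1; exact: cardD1.
have -> : #|disc fused_ring| = #|{: option 'I_k.+1}|.-1 + #|{: bool + bool}|.
  by rewrite card_sum card_sig; congr (_ + _); exact: cardD1.
by rewrite !card_sum !card_option !card_ord !card_bool; lia.
Qed.

Lemma branch_homeo : tangle_homeo false branch_disc branch_string branch_region.
Proof.
have [pd pe] := (tangle_planar branched_ring, tangle_planar fused_ring).
have fS := @glue_filled _ C false T' (transfer_planar k.+1) (transfer_collared k.+1)
  (coattach_filled i) (transfer_filled k.+1).
have fd := @glue_filled _ capped_ring (inr None) A (attach_planar i) (attach_collared i)
  fS (attach_filled i).
have fe := @glue_filled _ T (Some i) bang_data bang_planar bang_collared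
  (transfer_filled k) bang_filled.
apply: homeo_of_starts pe pd fe fd branch_disc_bij _ branch_string_flip branch_start branch_corner.
by move=> [[[j|] e]|[b|[]]].
Qed.

End Branching.

Section Algebra.
Variables (R : realType) (P : planar_algebra R).

(** The left hand side is the value of [branched_ring], the right hand side that
    of [fused_ring], and the two tangles are homeomorphic. *)
Lemma coattach_transfer_attach (Y : P 3) k (i : 'I_k.+1) (L : 'I_k.+1 -> P 4)
    (L' : 'I_k.+2 -> P 4) (xi : P k.+1) :
  (forall j, j != i -> L j = L' (left_leaf i j)) ->
  L i = bang Y (L' (left_leaf i i)) (L' (right_leaf i i)) ->
  coattach (star Y) i (transfer L' (attach Y i xi)) = transfer L xi.
Proof.
move=> Lj Li.
pose xT (e : option 'I_k.+1) : P (transfer_arity e) :=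
  match e return P (transfer_arity e) with None => xi | Some j => L j end.
pose yB (e : bool + bool) : P (bang_arity e) :=
  match e return P (bang_arity e) with
  | inl b => if b then L' (right_leaf i i) else L' (left_leaf i i)
  | inr b => if b then star Y else Y end.
pose xA (b : bool) : P (attach_arity k b) :=
  match b return P (attach_arity k b) with false => xi | true => Y end.
pose xT' (e : option 'I_k.+2) : P (transfer_arity e) :=
  match e return P (transfer_arity e) with None => attach Y i xi | Some j => L' j end.
pose xC (b : bool) : P (coattach_arity k b) :=
  match b return P (coattach_arity k b) with
  | false => transfer L' (attach Y i xi) | true => star Y end.
have eS := @act_glue_collared R P _ (coattach_tangle i) false (transfer_tangle k.+1)
  (transfer_collared k.+1) xC xT' erefl.
have ed := @act_glue_collared R P _ (capped_ring i) (inr None) (attach_tangle i)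
  (attach_collared i)
  (@glue_label _ (coattach_tangle i) false (transfer_tangle k.+1) (fun m => P m) xC xT')
  xA erefl.
have ee := @act_glue_collared R P _ (transfer_tangle k) (Some i) bang_tangle
  bang_collared xT yB (esym Li).
apply: etrans (esym (etrans ed eS)) (etrans _ ee); apply: act_isotopy (branch_homeo i) _.
case=> [[[j|] e]|[b|[]]] //=.
- by rewrite (Lj j e).
- by case: b.
Qed.

Lemma inner_transfer_attach (Y : P 3) k (i : 'I_k.+1) (L : 'I_k.+1 -> P 4)
    (L' : 'I_k.+2 -> P 4) (xi eta : P k.+1) :
  (forall j, j != i -> L j = L' (left_leaf i j)) ->
  L i = bang Y (L' (left_leaf i i)) (L' (right_leaf i i)) ->
  inner (transfer L' (attach Y i xi)) (attach Y i eta) = inner (transfer L xi) eta.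
Proof. by move=> Lj Li; rewrite inner_attach (coattach_transfer_attach xi Lj Li). Qed.

End Algebra.

(** * Branchings and words *)

Lemma words_branch t i (w := nth [::] (words t) i) : i < leaves t ->
  words (branch t i) =
  take i (words t) ++ [:: rcons w false; rcons w true] ++ drop i.+1 (words t).
Proof.
rewrite {}/w; have leavesE l r : leaves (Node l r) = leaves l + leaves r.
  by rewrite /leaves addSn addnS.
elim: t i => [|l IHl r IHr] i; first by case: i.
rewrite [words (branch _ _)](_ : _ = if i < leaves l
  then words (Node (branch l i) r) else words (Node l (branch r (i - leaves l))));
  last by rewrite /=; case: ifP.
rewrite leavesE => lti; rewrite [words (Node l r)]/= take_cat drop_cat nth_cat size_map size_words.
case: ltnP => li /=.
  rewrite IHl // !map_cat map_take -catA; congr (_ ++ _) => /=.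
  rewrite (nth_map [::]) ?size_words //=; do 2 congr (_ :: _).
  rewrite map_drop; case: ltnP => [//|ge]; rewrite drop_oversize ?size_map ?size_words //.
  suff -> : i.+1 - leaves l = 0 by rewrite drop0.
  lia.
have ltr : i - leaves l < leaves r by lia.
rewrite IHr // !map_cat map_take -catA; do 2 congr (_ ++ _) => /=.
rewrite (nth_map [::]) ?size_words //=; do 2 congr (_ :: _).
by rewrite ifN -?leqNgt ?subSn // ?map_drop //; lia.
Qed.

Lemma nth_words_branch t (i : 'I_(leaves t)) (s := words (branch t i)) :
  [/\ forall j : 'I_(leaves t), j != i -> nth [::] s (left_leaf i j) = nth [::] (words t) j,
      nth [::] s (left_leaf i i) = rcons (nth [::] (words t) i) false &
      nth [::] s (right_leaf i i) = rcons (nth [::] (words t) i) true].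
Proof.
have lti := ltn_ord i; rewrite {}/s words_branch //.
have st : size (take i (words t)) = i by rewrite size_takel // size_words ltnW.
split=> [j ji||]; rewrite nth_cat st ?left_leafE ?right_leafE.
- have nji : (j : nat) != i by [].
  case: (ltnP i j) => lij; last first.
    have lji : j < i by rewrite ltn_neqAle nji lij.
    by rewrite add0n lji nth_take.
  have nlt : (j.+1 < i) = false by apply/negbTE; rewrite -leqNgt ltnW // ltnW.
  rewrite add1n nlt.
  have -> : j.+1 - i = (j - i.+1).+2 by lia.
  by rewrite /= nth_drop subnKC.
- by rewrite ltnn add0n ltnn subnn.
- by rewrite leqnn add1n ltnNge leqnSn /= subSnn.
Qed.

Section Main.
Variables (R : realType) (P : planar_algebra R).

(** A tree obtained by branching has one leaf more only up to a provable
    equality, hence the transport. *)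
Lemma inner_transfer_cast k k' (e : k.+1 = k'.+1) (L : 'I_k'.+1 -> P 4) (z w : P k.+1) :
  inner (transfer L (cast_space e z)) (cast_space e w) =
  inner (transfer (fun j => L (cast_ord e j)) z) w.
Proof.
have ek := succn_inj e; move: e L; rewrite -ek => e L.
rewrite (eq_irrelevance e erefl) /=; congr (inner (transfer _ z) w).
by apply: functional_extensionality => j; rewrite cast_ord_id.
Qed.

(** Branching a leaf with word w removes L_w from the ring and puts L_(w0) and
    L_(w1) in its place. *)
Lemma weakly_scale_invariant_bang (Y : P 3) (L : seq bool -> P 4) :
  (forall w, L w = bang Y (L (rcons w false)) (L (rcons w true))) ->
  weakly_scale_invariant Y L.
Proof.
move=> Lw s t _ f; elim=> {t f} [//|t f i _ IH] xi eta.
rewrite -IH /tree_transfer inner_transfer_cast.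
have [nj nl nr] := nth_words_branch i.
apply: inner_transfer_attach => [j ji|] /=; first by rewrite nj.
by rewrite nl nr.
Qed.

End Main.

Theorem corollary3p3 (R : realType) (P : planar_algebra R)
    (P_pos : positive_definite P) (Y : P 3) (Y_isometric : isometric Y)
    (X : nat -> P 4) (X_back : forall i : nat, (1 <= i)%N -> renorm Y (X i.+1) = X i) :
  weakly_scale_invariant Y (length_labels Y X).
Proof.
(* For the empty word the label is R(X_1) by convention. *)
apply: weakly_scale_invariant_bang => -[|b w] //=.
by rewrite !size_rcons -[LHS]X_back.
Qed.
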